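(* Let $H$ be a separable Hilbert space, $0<p\le2$, and $T$ a bounded self-adjoint operator on $H$. The following are equivalent: (a) $T\in S_p$; (b) $\sum_{k=1}^\infty\sum_{n=1}^\infty|\langle Te_n,e_k\rangle|^p<\infty$ for some orthonormal basis $\{e_n\}$ of $H$; (c) $\sum_{k=1}^\infty\sum_{n=1}^\infty|\langle Tf_n,f_k\rangle|^p<\infty$ for some frame $\{f_n\}$ of $H$. Moreover, $$\|T\|_p^p=\inf\sum_{n,k}|\langle Te_n,e_k\rangle|^p=\inf\sum_{n,k}\|f_n\|^{2-p}|\langle Tf_n,f_k\rangle|^p=\inf\sum_{n,k}|\langle Tf_n,f_k\rangle|^p,$$ where the first infimum is over all orthonormal bases, the second over all frames with lower frame bound at least $1$, and the third over all Parseval frames. (Terms with $f_n=0$ are taken to be $0$.)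
   Context: A sequence $\{f_n\}$ in $H$ is a frame if there are constants $0<C_1\le C_2$ such that $C_1\|f\|^2\le\sum_n|\langle f,f_n\rangle|^2\le C_2\|f\|^2$ for all $f\in H$. The upper frame bound is the infimum of all admissible $C_2$. The lower frame bound is the supremum of all admissible $C_1$. A Parseval frame is one whose lower and upper frame bounds both equal $1$. For a compact operator $T$, its singular values $\lambda_1\ge\lambda_2\ge\cdots$ are the positive eigenvalues of $(T^*T)^{1/2}$, repeated according to multiplicity. For $0<p<\infty$, $S_p$ is the set of compact $T$ with $\{\lambda_n\}\in\ell^p$, and $\|T\|_p=(\sum_n\lambda_n^p)^{1/p}$. *)

(* Defs.v *)
From Stdlib Require Import Reals List.
Open Scope R_scope.

Definition C := (R * R)%type.
Definition C0 : C := (0, 0).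
Definition C1 : C := (1, 0).
Definition RtoC (r : R) : C := (r, 0).
Definition Cadd (z w : C) : C := (fst z + fst w, snd z + snd w).
Definition Cmul (z w : C) : C :=
  (fst z * fst w - snd z * snd w, fst z * snd w + snd z * fst w).
Definition Cconj (z : C) : C := (fst z, - snd z).
Definition Cabs (z : C) : R := sqrt (fst z ^ 2 + snd z ^ 2).

Record Hilb := {
  carrier :> Type;
  hzero : carrier;
  hadd : carrier -> carrier -> carrier;
  hopp : carrier -> carrier;
  hscal : C -> carrier -> carrier;
  hip : carrier -> carrier -> C;
  hadd_assoc : forall x y z, hadd x (hadd y z) = hadd (hadd x y) z;
  hadd_comm : forall x y, hadd x y = hadd y x;
  hadd_zero : forall x, hadd x hzero = x;
  hadd_opp : forall x, hadd x (hopp x) = hzero;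
  hscal_one : forall x, hscal C1 x = x;
  hscal_mul : forall a b x, hscal (Cmul a b) x = hscal a (hscal b x);
  hscal_addv : forall a x y, hscal a (hadd x y) = hadd (hscal a x) (hscal a y);
  hscal_adds : forall a b x, hscal (Cadd a b) x = hadd (hscal a x) (hscal b x);
  hip_add : forall x y z, hip (hadd x y) z = Cadd (hip x z) (hip y z);
  hip_scal : forall a x y, hip (hscal a x) y = Cmul a (hip x y);
  hip_conj : forall x y, hip y x = Cconj (hip x y);
  hip_pos : forall x, 0 <= fst (hip x x);
  hip_def : forall x, hip x x = C0 -> x = hzero;
  hcomplete : forall u : nat -> carrier,
    (forall eps, 0 < eps -> exists N, forall m n, (N <= m)%nat -> (N <= n)%nat ->
        sqrt (fst (hip (hadd (u m) (hopp (u n))) (hadd (u m) (hopp (u n))))) < eps) ->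
    exists l, forall eps, 0 < eps -> exists N, forall n, (N <= n)%nat ->
        sqrt (fst (hip (hadd (u n) (hopp l)) (hadd (u n) (hopp l)))) < eps
}.

Arguments hzero {h}.
Arguments hadd {h}.
Arguments hopp {h}.
Arguments hscal {h}.
Arguments hip {h}.

Section Defs.
Variable H : Hilb.

Definition hsub (x y : H) : H := hadd x (hopp y).
Definition hnorm (x : H) : R := sqrt (fst (hip x x)).

Definition separable : Prop :=
  exists d : nat -> H, forall (x : H) eps, 0 < eps -> exists n, hnorm (hsub x (d n)) < eps.

Definition hconverges (u : nat -> H) (l : H) : Prop :=
  forall eps, 0 < eps -> exists N, forall n, (N <= n)%nat -> hnorm (hsub (u n) l) < eps.

Definition linear_op (T : H -> H) : Prop :=
  (forall x y, T (hadd x y) = hadd (T x) (T y)) /\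
  (forall a x, T (hscal a x) = hscal a (T x)).

Definition bounded_op (T : H -> H) : Prop :=
  linear_op T /\ exists M, forall x, hnorm (T x) <= M * hnorm x.

Definition self_adjoint (T : H -> H) : Prop :=
  forall x y, hip (T x) y = hip x (T y).

Definition is_adjoint (T S : H -> H) : Prop :=
  forall x y, hip (T x) y = hip x (S y).

Definition compact_op (T : H -> H) : Prop :=
  bounded_op T /\
  forall u : nat -> H, (exists M, forall n, hnorm (u n) <= M) ->
    exists phi : nat -> nat, (forall n, (phi n < phi (S n))%nat) /\
      exists l, hconverges (fun n => T (u (phi n))) l.

Definition pos_sqrt (Rt A : H -> H) : Prop :=
  bounded_op Rt /\ self_adjoint Rt /\ (forall x, 0 <= fst (hip (Rt x) x)) /\
  forall x, Rt (Rt x) = A x.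

Fixpoint lincomb (l : list H) (c : nat -> C) : H :=
  match l with
  | nil => hzero
  | v :: l' => hadd (hscal (c O) v) (lincomb l' (fun n => c (S n)))
  end.

Definition in_span (l : list H) (x : H) : Prop := exists c, x = lincomb l c.

Definition orthonormal_list (l : list H) : Prop :=
  forall i j, (i < length l)%nat -> (j < length l)%nat ->
    hip (nth i l hzero) (nth j l hzero) = if Nat.eqb i j then C1 else C0.

Definition eig_mult (Rt : H -> H) (mu : R) (m : nat) : Prop :=
  exists l : list H, length l = m /\ orthonormal_list l /\
    forall x, Rt x = hscal (RtoC mu) x <-> in_span l x.

Definition count_val (lam : nat -> R) (mu : R) (m : nat) : Prop :=
  exists l : list nat, NoDup l /\ length l = m /\ forall n, In n l <-> lam n = mu.

(* lam = singular values of T: positive eigenvalues of (T^*T)^{1/2}, repeated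
   according to multiplicity, in nonincreasing order (padded with zeros) *)
Definition sing_vals (T : H -> H) (lam : nat -> R) : Prop :=
  exists Ta Rt, is_adjoint T Ta /\ pos_sqrt Rt (fun x => Ta (T x)) /\
    (forall n, 0 <= lam n) /\ (forall n, lam (S n) <= lam n) /\
    forall mu, 0 < mu -> forall m, eig_mult Rt mu m <-> count_val lam mu m.

(* x^p for x >= 0, p real, with the convention 0^p = 0 *)
Definition rpow (x p : R) : R := if Rle_dec x 0 then 0 else Rpower x p.

Definition In_Sp (p : R) (T : H -> H) : Prop :=
  compact_op T /\ exists lam, sing_vals T lam /\ exists s, infinite_sum (fun n => rpow (lam n) p) s.

Definition Sp_normp (p : R) (T : H -> H) (v : R) : Prop :=
  In_Sp p T /\ exists lam, sing_vals T lam /\ infinite_sum (fun n => rpow (lam n) p) v.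

Fixpoint lsum {I : Type} (l : list I) (f : I -> R) : R :=
  match l with nil => 0 | i :: l' => f i + lsum l' f end.

Definition usum {I : Type} (a : I -> R) (s : R) : Prop :=
  is_lub (fun r => exists l : list I, NoDup l /\ r = lsum l a) s.

Definition dsum {I : Type} (a : I -> I -> R) (s : R) : Prop :=
  is_lub (fun r => exists l : list I, NoDup l /\ r = lsum l (fun n => lsum l (fun k => a n k))) s.

Definition is_glb (E : R -> Prop) (m : R) : Prop :=
  (forall x, E x -> m <= x) /\ (forall b, (forall x, E x -> b <= x) -> b <= m).

Definition countable (I : Type) : Prop :=
  exists g : I -> nat, forall a b, g a = g b -> a = b.

Definition ONB {I : Type} (e : I -> H) : Prop :=
  (forall i, hip (e i) (e i) = C1) /\
  (forall i j, i <> j -> hip (e i) (e j) = C0) /\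
  (forall x, (forall i, hip x (e i) = C0) -> x = hzero).

Definition frame_sum {I : Type} (f : I -> H) (x : H) (s : R) : Prop :=
  usum (fun n => Cabs (hip x (f n)) ^ 2) s.

Definition frame {I : Type} (f : I -> H) : Prop :=
  exists C1' C2', 0 < C1' <= C2' /\
    forall x, exists s, frame_sum f x s /\
      C1' * hnorm x ^ 2 <= s /\ s <= C2' * hnorm x ^ 2.

Definition lower_adm {I : Type} (f : I -> H) (c : R) : Prop :=
  0 < c /\ forall x s, frame_sum f x s -> c * hnorm x ^ 2 <= s.

Definition upper_adm {I : Type} (f : I -> H) (c : R) : Prop :=
  0 < c /\ forall x s, frame_sum f x s -> s <= c * hnorm x ^ 2.

Definition lower_frame_bound {I : Type} (f : I -> H) (A : R) : Prop :=
  is_lub (lower_adm f) A.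

Definition upper_frame_bound {I : Type} (f : I -> H) (B : R) : Prop :=
  is_glb (upper_adm f) B.

Definition parseval {I : Type} (f : I -> H) : Prop :=
  frame f /\ lower_frame_bound f 1 /\ upper_frame_bound f 1.

Definition mat_sum {I : Type} (p : R) (T : H -> H) (e : I -> H) (s : R) : Prop :=
  dsum (fun n k => rpow (Cabs (hip (T (e n)) (e k))) p) s.

Definition wmat_sum {I : Type} (p : R) (T : H -> H) (f : I -> H) (s : R) : Prop :=
  dsum (fun n k => rpow (hnorm (f n)) (2 - p) * rpow (Cabs (hip (T (f n)) (f k))) p) s.

Definition ONB_vals (p : R) (T : H -> H) (r : R) : Prop :=
  exists (I : Type) (e : I -> H), countable I /\ ONB e /\ mat_sum p T e r.

Definition frame1_wvals (p : R) (T : H -> H) (r : R) : Prop :=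
  exists (I : Type) (f : I -> H), countable I /\ frame f /\
    (exists A, lower_frame_bound f A /\ 1 <= A) /\ wmat_sum p T f r.

Definition parseval_vals (p : R) (T : H -> H) (r : R) : Prop :=
  exists (I : Type) (f : I -> H), countable I /\ parseval f /\ mat_sum p T f r.

End Defs.

(* Main.v *)
Require Import Defs.
From Stdlib Require Import Reals List.
From Stdlib Require Import Lra Lia Wf_nat Compare_dec.
From Stdlib Require Import Classical ClassicalEpsilon FunctionalExtensionality.
Import Defs.
Open Scope R_scope.

(** A compact self-adjoint [T] is diagonalised by an orthonormal basis [E] with
    eigenvalues [tau], obtained by repeatedly splitting off a norm-attaining
    eigenvector and completing the resulting sequence inside the kernel; the matrix
    of [T] in [E] is diagonal, so its [p]-sum is [sum |tau_i|^p = ||T||_p^p] and all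
    three infima are attained at [E].

    Conversely let [f] be a frame with lower bound [c].  As [p / 2 <= 1],
    [sum_k |<T f_n, f_k>|^p >= (sum_k |<T f_n, f_k>|^2)^(p/2) >= c^(p/2) |T f_n|^p],
    and Hoelder's inequality gives
    [|f_n|^(2-p) |T f_n|^p >= sum_i |tau_i|^p |<f_n, E_i>|^2].
    Summing over [n] and using the lower bound at each [E_i] yields
    [sum_(n,k) |f_n|^(2-p) |<T f_n, f_k>|^p >= c^(1+p/2) sum_i |tau_i|^p].
    That [T] is compact to begin with follows because the [p]-sum dominates a
    Hilbert-Schmidt norm.

    Singular values are compared with eigenvalues of [T] through
    [ker (|T| - mu) = ker (T^2 - mu^2)] for [mu > 0], valid for every positive square
    root of [T^2]. *)

(** * Complex numbers and inner products *)

(** The exponent enters only through q = p/2 applied to squared moduli, hence the squared quantities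
    [csq] and [nsq]. The condition p <= 2 means q <= 1, and this concavity yields both subadditivity
    of t^q and the Hoelder step. Sums over a frame are suprema over finite lists, and such a
    supremum need not be attained. The lower frame inequality is therefore used with a slightly
    smaller constant, for which a finite list suffices, and the sharp constant 1 is recovered by
    letting c tend to 1. The three lower bounds reduce to one: vectors of a Parseval frame have norm
    at most 1, so the weights |f_n|^(2-p) are at most 1 and the weighted bound covers the unweighted
    sums; orthonormal bases are Parseval frames. Singular values are given by a relation that asks
    for some positive square root. So a root has to be constructed from the eigenbasis, and the
    sequence has to be shown independent of the root. *)

Definition csq (z : Defs.C) : R := fst z ^ 2 + snd z ^ 2.

Definition nsq {H : Hilb} (x : H) : R := fst (hip x x).

Ltac cring :=
  apply injective_projections; unfold Cadd, Cmul, Cconj, RtoC, C0, C1; simpl; ring.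

Lemma csq_ge0 z : 0 <= csq z.
Proof. unfold csq. nra. Qed.

Lemma csq_C0 : csq C0 = 0.
Proof. unfold csq, C0. simpl. ring. Qed.

Lemma csq_conj z : csq (Cconj z) = csq z.
Proof. unfold csq, Cconj. simpl. ring. Qed.

Lemma csq_mul z w : csq (Cmul z w) = csq z * csq w.
Proof. unfold csq, Cmul. simpl. ring. Qed.

Lemma csq_eq0 z : csq z <= 0 -> z = C0.
Proof.
  destruct z as [a b]. unfold csq, C0. simpl. intros Hz.
  assert (a = 0) by nra. assert (b = 0) by nra. subst. reflexivity.
Qed.

Lemma Cabs_sqr z : Cabs z ^ 2 = csq z.
Proof. unfold Cabs. apply pow2_sqrt, csq_ge0. Qed.

Lemma Cabs_ge0 z : 0 <= Cabs z.
Proof. apply sqrt_pos. Qed.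

Lemma Cmul_eq0 z w : Cmul z w = C0 -> z = C0 \/ w = C0.
Proof.
  intros E. assert (csq z * csq w = 0) as P by (rewrite <- csq_mul, E; apply csq_C0).
  apply Rmult_integral in P.
  destruct P; [left | right]; apply csq_eq0; lra.
Qed.

Lemma hip_zero_l {H : Hilb} (y : H) : hip hzero y = C0.
Proof.
  pose proof (hip_add H hzero hzero y) as E. rewrite hadd_zero in E.
  destruct (hip hzero y) as [a b]. unfold Cadd in E. simpl in E.
  injection E; intros. unfold C0. f_equal; lra.
Qed.

Lemma hip_zero_r {H : Hilb} (y : H) : hip y hzero = C0.
Proof. rewrite hip_conj, hip_zero_l. cring. Qed.

Lemma hip_addr {H : Hilb} (x y z : H) : hip x (hadd y z) = Cadd (hip x y) (hip x z).
Proof.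
  rewrite hip_conj, hip_add, (hip_conj _ x y), (hip_conj _ x z). cring.
Qed.

Lemma hip_scalr {H : Hilb} a (x y : H) : hip x (hscal a y) = Cmul (Cconj a) (hip x y).
Proof. rewrite hip_conj, hip_scal, (hip_conj _ x y). cring. Qed.

Lemma hip_opp_l {H : Hilb} (x y : H) : hip (hopp x) y = Cmul (RtoC (-1)) (hip x y).
Proof.
  pose proof (hip_add H x (hopp x) y) as E. rewrite hadd_opp, hip_zero_l in E.
  unfold C0, Cadd in E. injection E; intros.
  unfold Cmul, RtoC. apply injective_projections; simpl; lra.
Qed.

Lemma hip_opp_r {H : Hilb} (x y : H) : hip x (hopp y) = Cmul (RtoC (-1)) (hip x y).
Proof. rewrite hip_conj, hip_opp_l, (hip_conj _ x y). cring. Qed.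

#[local] Hint Rewrite @hip_add @hip_scal @hip_addr @hip_scalr @hip_opp_l @hip_opp_r
  @hip_zero_l @hip_zero_r : hip.

Lemma nsq_ge0 {H : Hilb} (x : H) : 0 <= nsq x.
Proof. apply hip_pos. Qed.

Lemma hip_self {H : Hilb} (x : H) : hip x x = RtoC (nsq x).
Proof.
  pose proof (hip_conj H x x) as E. unfold nsq, RtoC.
  destruct (hip x x) as [a b]. unfold Cconj in E. simpl in *.
  injection E; intros. f_equal; lra.
Qed.

Lemma nsq_eq0 {H : Hilb} (x : H) : nsq x <= 0 -> x = hzero.
Proof.
  intros E. apply hip_def. rewrite hip_self. unfold RtoC, C0. f_equal.
  pose proof (nsq_ge0 x). lra.
Qed.

Lemma nsq_zero {H : Hilb} : nsq (@hzero H) = 0.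
Proof. unfold nsq. rewrite hip_zero_l. reflexivity. Qed.

Lemma hip_ext {H : Hilb} (x y : H) : (forall z, hip x z = hip y z) -> x = y.
Proof.
  intros E.
  assert (hadd x (hopp y) = hzero) as D.
  { apply hip_def. rewrite hip_add, hip_opp_l, E. cring. }
  rewrite <- (hadd_zero _ y), <- D, (hadd_comm _ x), hadd_assoc, hadd_opp, hadd_comm.
  rewrite hadd_zero. reflexivity.
Qed.

(** Every vector identity is tested against an arbitrary vector, which turns it into a polynomial
    identity between inner products. *)
Ltac hring :=
  apply hip_ext; intro; unfold hsub; autorewrite with hip; cring.

Lemma hsub_eq0 {H : Hilb} (x y : H) : hsub H x y = hzero -> x = y.
Proof.
  intros E. apply hip_ext. intro z.
  assert (hip (hsub H x y) z = C0) as D by (rewrite E; apply hip_zero_l).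
  unfold hsub in D. autorewrite with hip in D. unfold Cadd, Cmul, RtoC, C0 in D.
  simpl in D. injection D; intros. apply injective_projections; lra.
Qed.

Lemma nsq_scal {H : Hilb} a (x : H) : nsq (hscal a x) = csq a * nsq x.
Proof.
  unfold nsq. autorewrite with hip. rewrite hip_self.
  unfold csq, Cmul, Cconj, RtoC. simpl. ring.
Qed.

Lemma nsq_opp {H : Hilb} (x : H) : nsq (hopp x) = nsq x.
Proof.
  unfold nsq. autorewrite with hip. unfold Cmul, RtoC. simpl. ring.
Qed.

Lemma nsq_add {H : Hilb} (x y : H) :
  nsq (hadd x y) = nsq x + 2 * fst (hip x y) + nsq y.
Proof.
  unfold nsq. autorewrite with hip. rewrite (hip_conj _ x y).
  unfold Cadd, Cconj. simpl. ring.
Qed.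

Lemma nsq_sub {H : Hilb} (x y : H) :
  nsq (hsub H x y) = nsq x - 2 * fst (hip x y) + nsq y.
Proof.
  unfold hsub. rewrite nsq_add, nsq_opp, hip_opp_r. unfold Cmul, RtoC. simpl. ring.
Qed.

Lemma nsq_sub_sym {H : Hilb} (x y : H) : nsq (hsub H x y) = nsq (hsub H y x).
Proof. rewrite !nsq_sub, (hip_conj _ x y). simpl. ring. Qed.

Lemma nsq_add_le {H : Hilb} (x y : H) : nsq (hadd x y) <= 2 * nsq x + 2 * nsq y.
Proof. pose proof (nsq_ge0 (hsub H x y)) as P. rewrite nsq_sub in P. rewrite nsq_add. lra. Qed.

Lemma nsq_sub_le {H : Hilb} (x y : H) : nsq (hsub H x y) <= 2 * nsq x + 2 * nsq y.
Proof. unfold hsub. rewrite <- (nsq_opp y). apply nsq_add_le. Qed.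

Lemma nsq_sub_trans {H : Hilb} (x y z : H) :
  nsq (hsub H x z) <= 2 * nsq (hsub H x y) + 2 * nsq (hsub H y z).
Proof.
  replace (hsub H x z) with (hadd (hsub H x y) (hsub H y z)) by hring. apply nsq_add_le.
Qed.

(** No sign is assumed for [K], so an error estimate linear in [eps] can be used without first
    checking its constant. *)
Lemma arbitrarily_small a K : (forall eps, 0 < eps -> a <= K * eps) -> a <= 0.
Proof.
  intros E. apply Rnot_lt_le. intro P.
  assert (0 < Rabs K + 1) as PK by (pose proof (Rabs_pos K); lra).
  assert (0 < a / (2 * (Rabs K + 1))) as Q by (apply Rdiv_lt_0_compat; lra).
  specialize (E _ Q). pose proof (Rle_abs K) as L.
  assert (K * (a / (2 * (Rabs K + 1))) <= (Rabs K + 1) * (a / (2 * (Rabs K + 1))))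
    as L2 by (apply Rmult_le_compat_r; lra).
  replace ((Rabs K + 1) * (a / (2 * (Rabs K + 1)))) with (a / 2) in L2 by (field; lra).
  lra.
Qed.

(** The vector |y|^2 x - <x, y> y avoids a division; expanding its squared norm gives the inequality
    multiplied by |y|^2. *)
Lemma cauchy_schwarz {H : Hilb} (x y : H) : csq (hip x y) <= nsq x * nsq y.
Proof.
  pose proof (nsq_ge0 (hsub H (hscal (RtoC (nsq y)) x) (hscal (hip x y) y))) as P.
  rewrite nsq_sub, !nsq_scal in P. autorewrite with hip in P.
  destruct (Rle_lt_dec (nsq y) 0) as [Z | Z].
  - rewrite (nsq_eq0 _ Z), hip_zero_r, nsq_zero, csq_C0. lra.
  - unfold csq, RtoC, Cmul, Cconj in *. simpl in *.
    apply Rmult_le_reg_l with (nsq y); [exact Z |]. nra.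
Qed.

Lemma hnorm_sqr {H : Hilb} (x : H) : hnorm H x ^ 2 = nsq x.
Proof. unfold hnorm. apply pow2_sqrt, nsq_ge0. Qed.

Lemma hnorm_ge0 {H : Hilb} (x : H) : 0 <= hnorm H x.
Proof. apply sqrt_pos. Qed.

Lemma hnorm_lt {H : Hilb} (x : H) eps : nsq x < eps ^ 2 -> 0 < eps -> hnorm H x < eps.
Proof. intros A B. rewrite <- hnorm_sqr in A. pose proof (hnorm_ge0 x). nra. Qed.

Lemma hnorm_lt_sqrt {H : Hilb} (x : H) eps : 0 < eps -> hnorm H x < sqrt eps -> nsq x < eps.
Proof.
  intros P L. rewrite <- hnorm_sqr. pose proof (hnorm_ge0 x).
  pose proof (pow2_sqrt eps (Rlt_le _ _ P)). nra.
Qed.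

Lemma hconverges_nsq {H : Hilb} (u : nat -> H) l :
  hconverges H u l <->
  forall eps, 0 < eps -> exists N, forall n, (N <= n)%nat -> nsq (hsub H (u n) l) < eps.
Proof.
  split; intros E eps P.
  - destruct (E (sqrt eps) (sqrt_lt_R0 _ P)) as [N HN]. exists N. intros n Hn.
    apply hnorm_lt_sqrt; auto.
  - destruct (E (eps ^ 2)) as [N HN]; [nra |]. exists N. intros n Hn.
    apply hnorm_lt; auto.
Qed.

Lemma cauchy_converges {H : Hilb} (u : nat -> H) :
  (forall eps, 0 < eps -> exists N, forall m n, (N <= m)%nat -> (N <= n)%nat ->
     nsq (hsub H (u m) (u n)) < eps) ->
  exists l, hconverges H u l.
Proof.
  intros E. apply (hcomplete H u). intros eps P.
  destruct (E (eps ^ 2)) as [N HN]; [nra |]. exists N. intros m n Hm Hn.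
  apply (hnorm_lt (hsub H (u m) (u n))); auto.
Qed.

Lemma converges_cauchy {H : Hilb} (u : nat -> H) l :
  hconverges H u l ->
  forall eps, 0 < eps -> exists N, forall m n, (N <= m)%nat -> (N <= n)%nat ->
     nsq (hsub H (u m) (u n)) < eps.
Proof.
  intros E eps P. rewrite hconverges_nsq in E.
  destruct (E (eps / 4)) as [N HN]; [lra |]. exists N. intros m n Hm Hn.
  pose proof (nsq_sub_trans (u m) l (u n)). pose proof (HN m Hm). pose proof (HN n Hn) as Q.
  rewrite nsq_sub_sym in Q. lra.
Qed.

Lemma bounded_nsq {H : Hilb} (T : H -> H) : bounded_op H T ->
  exists K, 0 < K /\ forall x, nsq (T x) <= K * nsq x.
Proof.
  intros [_ [M HM]]. exists (M ^ 2 + 1). split; [nra |]. intros x.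
  specialize (HM x). rewrite <- !hnorm_sqr.
  pose proof (hnorm_ge0 x). pose proof (hnorm_ge0 (T x)).
  assert (hnorm H (T x) ^ 2 <= (M * hnorm H x) ^ 2) by (apply pow_incr; lra). nra.
Qed.

Lemma bounded_of_nsq {H : Hilb} (T : H -> H) K : 0 <= K -> linear_op H T ->
  (forall x, nsq (T x) <= K * nsq x) -> bounded_op H T.
Proof.
  intros PK L B. split; [exact L |]. exists (sqrt K). intros x.
  unfold hnorm. rewrite <- sqrt_mult; [| exact PK | apply nsq_ge0].
  apply sqrt_le_1_alt, B.
Qed.

Lemma linear_zero {H : Hilb} (T : H -> H) : linear_op H T -> T hzero = hzero.
Proof.
  intros [_ S]. replace (@hzero H) with (hscal C0 (@hzero H)) at 1 by hring.
  rewrite S. hring.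
Qed.

Lemma linear_sub {H : Hilb} (T : H -> H) x y :
  linear_op H T -> T (hsub H x y) = hsub H (T x) (T y).
Proof.
  intros [A S]. replace (hsub H x y) with (hadd x (hscal (RtoC (-1)) y)) by hring.
  rewrite A, S. hring.
Qed.

Lemma exists_unit_multiple {H : Hilb} (x : H) : x <> hzero ->
  exists r, 0 < r /\ r ^ 2 * nsq x = 1 /\ hip (hscal (RtoC r) x) (hscal (RtoC r) x) = C1.
Proof.
  intros N.
  assert (0 < nsq x) as P.
  { apply Rnot_le_lt. intro. apply N, nsq_eq0; assumption. }
  assert ((/ sqrt (nsq x)) ^ 2 * nsq x = 1) as E.
  { rewrite pow_inv, pow2_sqrt by lra. field. lra. }
  exists (/ sqrt (nsq x)). repeat split; auto.
  - apply Rinv_0_lt_compat, sqrt_lt_R0, P.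
  - rewrite hip_self, nsq_scal. unfold csq, RtoC, C1. simpl fst; simpl snd.
    f_equal. lra.
Qed.

(** * Sums over finite lists *)

Lemma lsum_ext {I : Type} (l : list I) f g :
  (forall i, In i l -> f i = g i) -> lsum l f = lsum l g.
Proof.
  induction l as [| i l IH]; simpl; intros E; [reflexivity |].
  rewrite E, IH; auto.
Qed.

Lemma lsum_le {I : Type} (l : list I) f g :
  (forall i, In i l -> f i <= g i) -> lsum l f <= lsum l g.
Proof.
  induction l as [| i l IH]; simpl; intros E; [lra |].
  apply Rplus_le_compat; auto.
Qed.

Lemma lsum_ge0 {I : Type} (l : list I) f : (forall i, 0 <= f i) -> 0 <= lsum l f.
Proof. intros P. induction l; simpl; [lra | specialize (P a); lra]. Qed.

Lemma lsum_eq0 {I : Type} (l : list I) f : (forall i, In i l -> f i = 0) -> lsum l f = 0.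
Proof.
  induction l as [| i l IH]; simpl; intros E; [reflexivity |].
  rewrite E, IH; auto. lra.
Qed.

Lemma lsum_scal {I : Type} (l : list I) f a : lsum l (fun i => a * f i) = a * lsum l f.
Proof. induction l; simpl; lra. Qed.

Lemma lsum_plus {I : Type} (l : list I) f g :
  lsum l (fun i => f i + g i) = lsum l f + lsum l g.
Proof. induction l; simpl; lra. Qed.

Lemma lsum_const {I : Type} (l : list I) a : lsum l (fun _ => a) = INR (length l) * a.
Proof.
  induction l as [| i l IH]; [simpl; ring |].
  change (length (i :: l)) with (S (length l)). rewrite S_INR. simpl. rewrite IH. ring.
Qed.

Lemma lsum_app {I : Type} (l1 l2 : list I) f : lsum (l1 ++ l2) f = lsum l1 f + lsum l2 f.
Proof. induction l1; simpl; lra. Qed.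

Lemma lsum_map {I J : Type} (g : I -> J) (l : list I) f :
  lsum (map g l) f = lsum l (fun i => f (g i)).
Proof. induction l; simpl; congruence. Qed.

Lemma lsum_swap {I J : Type} (l : list I) (l' : list J) f :
  lsum l (fun i => lsum l' (fun j => f i j)) = lsum l' (fun j => lsum l (fun i => f i j)).
Proof.
  induction l; simpl.
  - symmetry. apply lsum_eq0. auto.
  - rewrite IHl, <- lsum_plus. reflexivity.
Qed.

Lemma lsum_term_le {I : Type} (l : list I) f i :
  (forall i, 0 <= f i) -> In i l -> f i <= lsum l f.
Proof.
  intros P. induction l as [| j l IH]; simpl; [tauto |].
  intros [-> | Hi].
  - pose proof (lsum_ge0 l f P). lra.
  - specialize (IH Hi). specialize (P j). lra.
Qed.

Lemma lsum_incl {I : Type} (l u : list I) f :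
  (forall i, 0 <= f i) -> NoDup l -> incl l u -> lsum l f <= lsum u f.
Proof.
  intros P. revert u. induction l as [| i l IH]; intros u ND IN; simpl.
  - apply lsum_ge0, P.
  - inversion ND; subst.
    destruct (in_split i u) as [u1 [u2 ->]]; [apply IN; left; reflexivity |].
    assert (incl l (u1 ++ u2)) as IN2.
    { intros j Hj. assert (In j (u1 ++ i :: u2)) as Q by (apply IN; right; exact Hj).
      rewrite in_app_iff in *. simpl in Q. destruct Q as [Q | [<- | Q]]; tauto. }
    specialize (IH (u1 ++ u2) H2 IN2). rewrite !lsum_app in *. simpl. lra.
Qed.

Lemma NoDup_union {I : Type} (l1 l2 : list I) :
  exists u, NoDup u /\ incl l1 u /\ incl l2 u.
Proof.
  exists (nodup (fun x y => excluded_middle_informative (x = y)) (l1 ++ l2)).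
  split; [apply NoDup_nodup |].
  split; intros i Hi; apply nodup_In, in_app_iff; tauto.
Qed.

Lemma lsum_split_pred {I : Type} (P : I -> Prop) (l : list I) f :
  let b := fun i => if excluded_middle_informative (P i) then true else false in
  lsum l f = lsum (filter b l) f + lsum (filter (fun i => negb (b i)) l) f.
Proof.
  intros b. induction l as [| i l IH]; simpl; [lra |].
  destruct (b i); simpl; lra.
Qed.

(** The list comes within [eps] of the supremum of all finite sums. Applied to [l0 ++ Q] with [Q]
    disjoint from [l0], the bound says that finite sums outside [l0] are at most [eps]; this
    replaces convergence of an unordered series. *)
Lemma small_tail {I : Type} (a : I -> R) B eps :
  (forall i, 0 <= a i) -> (forall l, NoDup l -> lsum l a <= B) -> 0 < eps ->
  exists l0, NoDup l0 /\ forall u, NoDup u -> lsum u a <= lsum l0 a + eps.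
Proof.
  intros P HB He.
  destruct (completeness (fun r => exists l : list I, NoDup l /\ r = lsum l a)) as [s [U L]].
  - exists B. intros r [l [ND ->]]. auto.
  - exists 0, nil. split; [constructor | reflexivity].
  - destruct (classic (exists l, NoDup l /\ s - eps <= lsum l a)) as [[l [ND E]] | N].
    + exists l. split; [exact ND |]. intros u Hu.
      assert (lsum u a <= s) by (apply U; eauto). lra.
    + assert (s <= s - eps); [| lra].
      apply L. intros r [l [ND ->]]. apply Rnot_lt_le. intro. apply N. exists l.
      split; [auto | lra].
Qed.

Fixpoint vsum {H : Hilb} {I : Type} (l : list I) (u : I -> H) : H :=
  match l with nil => hzero | i :: l' => hadd (u i) (vsum l' u) end.

Lemma linear_vsum {H : Hilb} {I : Type} (T : H -> H) (l : list I) u :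
  linear_op H T -> T (vsum l u) = vsum l (fun i => T (u i)).
Proof.
  intros L. induction l; simpl; [apply linear_zero, L |].
  destruct L as [A S]. rewrite A, IHl. reflexivity.
Qed.

(** * Orthogonal families and the Riesz-Fischer theorem *)

(* Null vectors are tolerated, so that sequences produced by a terminating
   construction can be padded with zeros. *)
Definition orthofam {H : Hilb} {I : Type} (E : I -> H) : Prop :=
  (forall i j, i <> j -> hip (E i) (E j) = C0) /\
  (forall i, E i = hzero \/ hip (E i) (E i) = C1).

Definition supported {H : Hilb} {I : Type} (E : I -> H) (c : I -> Defs.C) : Prop :=
  forall i, E i = hzero -> c i = C0.

Definition fourier_sum {H : Hilb} {I : Type} (E : I -> H) (c : I -> Defs.C) (l : list I) : H :=
  vsum l (fun i => hscal (c i) (E i)).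

Lemma supported_hip {H : Hilb} {I : Type} (E : I -> H) x : supported E (fun i => hip x (E i)).
Proof. intros i Z. rewrite Z. apply hip_zero_r. Qed.

Lemma fourier_coef_out {H : Hilb} {I : Type} (E : I -> H) c l j :
  orthofam E -> ~ In j l -> hip (fourier_sum E c l) (E j) = C0.
Proof.
  intros [O _]. unfold fourier_sum. induction l as [| i l IH]; simpl; intros N.
  - apply hip_zero_l.
  - autorewrite with hip. rewrite IH by tauto. rewrite O by tauto. cring.
Qed.

Lemma fourier_coef_in {H : Hilb} {I : Type} (E : I -> H) c l j :
  orthofam E -> supported E c -> NoDup l -> In j l -> hip (fourier_sum E c l) (E j) = c j.
Proof.
  intros O S. induction l as [| i l IH]; simpl; intros ND Hj; [tauto |].
  inversion ND; subst. unfold fourier_sum; simpl. autorewrite with hip.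
  change (vsum l _) with (fourier_sum E c l).
  destruct (classic (i = j)) as [-> | N].
  - rewrite fourier_coef_out by auto. destruct (proj2 O j) as [Z | U].
    + rewrite (S j Z). cring.
    + rewrite U. cring.
  - destruct Hj as [-> | Hj]; [tauto |]. rewrite IH by auto.
    rewrite (proj1 O) by auto. cring.
Qed.

Lemma hip_fourier_sum {H : Hilb} {I : Type} (E : I -> H) c l x :
  (forall i, In i l -> hip x (E i) = c i) ->
  fst (hip x (fourier_sum E c l)) = lsum l (fun i => csq (c i)).
Proof.
  unfold fourier_sum. induction l as [| i l IH]; simpl; intros Hx.
  - rewrite hip_zero_r. reflexivity.
  - autorewrite with hip. rewrite Hx by auto. unfold Cadd at 1. simpl fst.
    rewrite IH by auto. unfold csq. simpl. ring.
Qed.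

Lemma nsq_fourier_sum {H : Hilb} {I : Type} (E : I -> H) c l :
  orthofam E -> supported E c -> NoDup l ->
  nsq (fourier_sum E c l) = lsum l (fun i => csq (c i)).
Proof.
  intros. apply hip_fourier_sum. intros. apply fourier_coef_in; auto.
Qed.

Lemma nsq_sub_fourier_sum {H : Hilb} {I : Type} (E : I -> H) c l x :
  orthofam E -> supported E c -> NoDup l -> (forall i, In i l -> hip x (E i) = c i) ->
  nsq (hsub H x (fourier_sum E c l)) = nsq x - lsum l (fun i => csq (c i)).
Proof.
  intros. rewrite nsq_sub, nsq_fourier_sum, hip_fourier_sum by auto. ring.
Qed.

Lemma bessel {H : Hilb} {I : Type} (E : I -> H) l x :
  orthofam E -> NoDup l -> lsum l (fun i => csq (hip x (E i))) <= nsq x.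
Proof.
  intros O ND.
  pose proof (nsq_ge0 (hsub H x (fourier_sum E (fun i => hip x (E i)) l))) as P.
  rewrite nsq_sub_fourier_sum in P; auto; [lra | apply supported_hip].
Qed.

Lemma inv_INR_S_pos n : 0 < / INR (S n).
Proof. apply Rinv_0_lt_compat, lt_0_INR. lia. Qed.

Lemma inv_INR_S_small eps : 0 < eps -> exists N, forall n, (N <= n)%nat -> / INR (S n) < eps.
Proof.
  intros P. destruct (INR_unbounded (/ eps)) as [N HN]. exists N. intros n Hn.
  rewrite <- (Rinv_inv eps). apply Rinv_lt_contravar.
  - apply Rmult_lt_0_compat; [apply Rinv_0_lt_compat, P | apply lt_0_INR; lia].
  - apply Rlt_le_trans with (INR N); [exact HN | apply le_INR; lia].
Qed.

(** Partial sums are taken along finite lists [L n] whose square sum is within 1/(n+1) of the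
    supremum, so the index type needs no enumeration. *)
Lemma riesz_fischer {H : Hilb} {I : Type} (E : I -> H) c B :
  orthofam E -> supported E c ->
  (forall l, NoDup l -> lsum l (fun i => csq (c i)) <= B) ->
  exists y, (forall i, hip y (E i) = c i) /\
    forall eps, 0 < eps -> exists l, NoDup l /\ nsq (hsub H y (fourier_sum E c l)) < eps.
Proof.
  intros O S HB.
  assert (forall i, 0 <= csq (c i)) as P by (intro; apply csq_ge0).
  destruct (choice (fun n l => NoDup l /\ forall u, NoDup u ->
    lsum u (fun i => csq (c i)) <= lsum l (fun i => csq (c i)) + / INR (Datatypes.S n)))
    as [L HL].
  { intro n. apply (small_tail (fun i => csq (c i)) B); auto. apply inv_INR_S_pos. }
  assert (forall n u, NoDup u -> incl (L n) u ->
    nsq (hsub H (fourier_sum E c u) (fourier_sum E c (L n))) <= / INR (Datatypes.S n)) as D.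
  { intros n u Hu IN. destruct (HL n) as [ND T].
    rewrite nsq_sub_fourier_sum, nsq_fourier_sum; auto.
    - specialize (T u Hu). lra.
    - intros i Hi. apply fourier_coef_in; auto. }
  destruct (cauchy_converges (fun n => fourier_sum E c (L n))) as [y Hy].
  { intros eps He. destruct (inv_INR_S_small (eps / 4)) as [N HN]; [lra |].
    exists N. intros m n Hm Hn.
    (* [L m] and [L n] need not be nested, so both partial sums are compared with the one over a
       common superset. *)
    destruct (NoDup_union (L m) (L n)) as [u [Hu [I1 I2]]].
    pose proof (nsq_sub_trans (fourier_sum E c (L m)) (fourier_sum E c u)
      (fourier_sum E c (L n))) as T.
    rewrite (nsq_sub_sym (fourier_sum E c (L m)) (fourier_sum E c u)) in T.
    pose proof (D m u Hu I1). pose proof (D n u Hu I2).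
    pose proof (HN m Hm). pose proof (HN n Hn). lra. }
  rewrite hconverges_nsq in Hy.
  exists y. split.
  - intros i. assert (csq (Cadd (hip y (E i)) (Cmul (RtoC (-1)) (c i))) <= 0) as Z.
    { apply Rnot_lt_le. intro Q.
      set (d := csq (Cadd (hip y (E i)) (Cmul (RtoC (-1)) (c i)))) in *.
      destruct (Hy (d / 4)) as [N1 HN1]; [lra |].
      destruct (inv_INR_S_small (d / 4)) as [N2 HN2]; [lra |].
      pose (n := Nat.max N1 N2).
      specialize (HN1 n (Nat.le_max_l _ _)). specialize (HN2 n (Nat.le_max_r _ _)).
      destruct (HL n) as [ND T].
      assert (csq (Cadd (hip (fourier_sum E c (L n)) (E i)) (Cmul (RtoC (-1)) (c i)))
        <= / INR (Datatypes.S n)) as B1.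
      { destruct (classic (In i (L n))) as [Hi | Hi].
        - rewrite fourier_coef_in by auto. pose proof (inv_INR_S_pos n).
          replace (Cadd (c i) (Cmul (RtoC (-1)) (c i))) with C0 by cring.
          rewrite csq_C0. lra.
        (* The partial sum has coefficient 0 here; adding [i] to the list shows that |c_i|^2 itself
           belongs to the tail. *)
        - rewrite fourier_coef_out by auto.
          specialize (T (i :: L n)). simpl in T.
          assert (NoDup (i :: L n)) as ND' by (constructor; auto). specialize (T ND').
          unfold csq, Cadd, Cmul, RtoC, C0 in *. simpl in *. lra. }
      pose proof (cauchy_schwarz (hsub H (fourier_sum E c (L n)) y) (E i)) as CS.
      assert (nsq (E i) <= 1) as NE.
      { destruct (proj2 O i) as [Z | U].
        - rewrite Z, nsq_zero. lra.
        - unfold nsq. rewrite U. simpl. lra. }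
      assert (csq (hip (hsub H (fourier_sum E c (L n)) y) (E i)) < d / 4) as B2.
      { pose proof (nsq_ge0 (hsub H (fourier_sum E c (L n)) y)).
        pose proof (nsq_ge0 (E i)). nra. }
      unfold hsub in B2. autorewrite with hip in B2.
      unfold d, csq, Cadd, Cmul, RtoC in *. simpl in *.
      set (a1 := fst (hip y (E i))) in *. set (a2 := snd (hip y (E i))) in *.
      set (s1 := fst (hip (fourier_sum E c (L n)) (E i))) in *.
      set (s2 := snd (hip (fourier_sum E c (L n)) (E i))) in *.
      set (c1 := fst (c i)) in *. set (c2 := snd (c i)) in *.
      (* These squares yield |a - c|^2 <= 2 |s - a|^2 + 2 |s - c|^2, while both terms on the right
         involve quantities below d/4. *)
      pose proof (pow2_ge_0 ((s1 - a1) + (s1 - c1))).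
      pose proof (pow2_ge_0 ((s2 - a2) + (s2 - c2))).
      nra. }
    apply csq_eq0 in Z. unfold Cadd, Cmul, RtoC, C0 in Z. simpl in Z. injection Z; intros.
    apply injective_projections; lra.
  - intros eps He. destruct (Hy eps He) as [N HN]. exists (L N).
    split; [apply HL |]. rewrite nsq_sub_sym. auto.
Qed.

Lemma ONB_orthofam {H : Hilb} {I : Type} (E : I -> H) : ONB H E -> orthofam E.
Proof. intros [U [O _]]. split; auto. Qed.

Lemma ONB_nonzero {H : Hilb} {I : Type} (E : I -> H) i : ONB H E -> E i <> hzero.
Proof.
  intros [U _] Z. specialize (U i). rewrite Z, hip_zero_l in U.
  unfold C0, C1 in U. injection U; lra.
Qed.

Lemma ONB_supported {H : Hilb} {I : Type} (E : I -> H) c : ONB H E -> supported E c.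
Proof. intros O i Z. destruct (ONB_nonzero E i O Z). Qed.

Lemma ONB_ext {H : Hilb} {I : Type} (E : I -> H) x y :
  ONB H E -> (forall i, hip x (E i) = hip y (E i)) -> x = y.
Proof.
  intros [_ [_ Tot]] Q. apply hsub_eq0, Tot. intro i.
  unfold hsub. autorewrite with hip. rewrite Q. cring.
Qed.

(** The vector that [riesz_fischer] builds from the coefficients of [x] has the same coefficients as
    [x], hence equals [x] by totality. *)
Lemma ONB_dense {H : Hilb} {I : Type} (E : I -> H) x eps : ONB H E -> 0 < eps ->
  exists l, NoDup l /\ nsq (hsub H x (fourier_sum E (fun i => hip x (E i)) l)) < eps.
Proof.
  intros O He. pose proof (ONB_orthofam E O) as OF.
  destruct (riesz_fischer E (fun i => hip x (E i)) (nsq x)) as [y [Cy Ay]]; auto.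
  - apply supported_hip.
  - intros. apply bessel; auto.
  - rewrite <- (ONB_ext E y x O Cy).
    replace (fun i => hip y (E i)) with (fun i => hip x (E i)); auto.
    apply functional_extensionality. auto.
Qed.

Lemma parseval_identity {H : Hilb} {I : Type} (E : I -> H) x : ONB H E ->
  usum (fun i => csq (hip x (E i))) (nsq x).
Proof.
  intros O. pose proof (ONB_orthofam E O) as OF. split.
  - intros r [l [ND ->]]. apply bessel; auto.
  - intros b Hb. apply Rnot_lt_le. intro L.
    destruct (ONB_dense E x (nsq x - b) O) as [l [ND A]]; [lra |].
    rewrite nsq_sub_fourier_sum in A; auto; [| apply supported_hip].
    assert (lsum l (fun i => csq (hip x (E i))) <= b) by (apply Hb; eauto). lra.
Qed.

(** * Compact self-adjoint operators *)

Lemma strictly_increasing_ge (phi : nat -> nat) :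
  (forall n, (phi n < phi (S n))%nat) -> forall n, (n <= phi n)%nat.
Proof. intros Hp n. induction n; [lia | specialize (Hp n); lia]. Qed.

Lemma hip_self_adjoint_sqr {H : Hilb} (A : H -> H) (x : H) :
  self_adjoint H A -> hip (A (A x)) x = RtoC (nsq (A x)).
Proof. intros SA. rewrite SA. apply hip_self. Qed.

(* If [nsq (A x)] almost reaches the supremum [m], then [x] is almost an
   eigenvector of [A^2] for [m]; compactness turns this into a genuine one. *)
Lemma sqr_eigenvector {H : Hilb} (A : H -> H) m :
  compact_op H A -> self_adjoint H A -> 0 < m ->
  (forall x, nsq (A x) <= m * nsq x) ->
  (forall eps, 0 < eps -> exists x, nsq x <= 1 /\ m - eps < nsq (A x)) ->
  exists y, y <> hzero /\ A (A y) = hscal (RtoC m) y.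
Proof.
  intros [[L _] CO] SA Pm HB HS.
  destruct (choice (fun n x => nsq x <= 1 /\ m - / INR (S n) < nsq (A x))) as [u Hu].
  { intro n. apply HS, inv_INR_S_pos. }
  destruct (CO u) as [phi [Hphi [y Hy]]].
  { exists 1. intro n. unfold hnorm. rewrite <- sqrt_1. apply sqrt_le_1_alt, Hu. }
  rewrite hconverges_nsq in Hy. pose proof (strictly_increasing_ge phi Hphi) as Hge.
  (* Expand |A^2 x - m x|^2 = |A^2 x|^2 - 2 m |A x|^2 + m^2 |x|^2 and use |A^2 x|^2 <= m |A x|^2. *)
  assert (forall x, nsq x <= 1 ->
    nsq (hsub H (A (A x)) (hscal (RtoC m) x)) <= m * (m - nsq (A x))) as K.
  { intros x Hx. rewrite nsq_sub, hip_scalr, nsq_scal, hip_self_adjoint_sqr by auto.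
    pose proof (HB (A x)). unfold csq, RtoC, Cmul, Cconj. simpl. nra. }
  exists y. split.
  - intros ->. destruct (Hy (m / 2)) as [N1 HN1]; [lra |].
    destruct (inv_INR_S_small (m / 2)) as [N2 HN2]; [lra |].
    pose (n := Nat.max N1 N2).
    specialize (HN1 n (Nat.le_max_l _ _)).
    assert (N2 <= phi n)%nat as Q by (specialize (Hge n); lia).
    specialize (HN2 _ Q). destruct (Hu (phi n)) as [_ Hn].
    replace (hsub H (A (u (phi n))) hzero) with (A (u (phi n))) in HN1 by hring. lra.
  - apply hsub_eq0. apply nsq_eq0, (arbitrarily_small _ (8 * m ^ 2 + 4 * m ^ 2)).
    intros eps He.
    destruct (Hy eps He) as [N1 HN1]. destruct (inv_INR_S_small eps He) as [N2 HN2].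
    pose (n := Nat.max N1 N2).
    specialize (HN1 n (Nat.le_max_l _ _)).
    assert (N2 <= phi n)%nat as Q by (specialize (Hge n); lia).
    specialize (HN2 _ Q). destruct (Hu (phi n)) as [Hn1 Hn2].
    set (x := u (phi n)) in *.
    pose proof (nsq_sub_sym (A x) y) as SY.
    (* Only the images [A x] converge, to [y]. The splitting A^2 (y - A x) + m (A x - y) + A (A^2 x
       - m x) never compares [x] itself with a limit. *)
    replace (hsub H (A (A y)) (hscal (RtoC m) y)) with
      (hadd (hadd (A (A (hsub H y (A x)))) (hscal (RtoC m) (hsub H (A x) y)))
        (A (hsub H (A (A x)) (hscal (RtoC m) x)))).
    2: { rewrite !(linear_sub A) by auto. rewrite (proj2 L). hring. }
    pose proof (nsq_add_le (hadd (A (A (hsub H y (A x)))) (hscal (RtoC m) (hsub H (A x) y)))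
        (A (hsub H (A (A x)) (hscal (RtoC m) x)))) as T1.
    pose proof (nsq_add_le (A (A (hsub H y (A x)))) (hscal (RtoC m) (hsub H (A x) y))) as T2.
    rewrite nsq_scal in T2.
    pose proof (HB (A (hsub H y (A x)))) as T3. pose proof (HB (hsub H y (A x))) as T4.
    pose proof (HB (hsub H (A (A x)) (hscal (RtoC m) x))) as T5. pose proof (K x Hn1) as T6.
    assert (csq (RtoC m) = m ^ 2) as CM by (unfold csq, RtoC; simpl; ring).
    rewrite CM, SY in T2. rewrite SY in HN1.
    assert (nsq (A (A (hsub H y (A x)))) <= m ^ 2 * eps) by nra.
    assert (m ^ 2 * nsq (hsub H y (A x)) <= m ^ 2 * eps) by nra.
    assert (m * (m - nsq (A x)) <= m * eps) by nra.
    assert (nsq (A (hsub H (A (A x)) (hscal (RtoC m) x))) <= m ^ 2 * eps) by nra.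
    assert (0 < m ^ 2 * eps) by (apply Rmult_lt_0_compat; [nra | exact He]).
    lra.
Qed.

(** With s = sqrt m, the eigenvector [y] of the square satisfies (A - s)(A + s) y = 0: if (A + s) y
    vanishes, [y] belongs to -s, otherwise (A + s) y belongs to s. The zero operator returns [t = 0]
    and a null vector, so that the iteration never has to stop. *)
Lemma compact_top_eigenvector {H : Hilb} (A : H -> H) :
  compact_op H A -> self_adjoint H A ->
  exists t e, A e = hscal (RtoC t) e /\ (forall x, nsq (A x) <= t ^ 2 * nsq x) /\
    (t = 0 /\ e = hzero \/ t <> 0 /\ hip e e = C1).
Proof.
  intros CO SA. pose proof CO as [BO _]. pose proof BO as [L _].
  destruct (classic (forall x, A x = hzero)) as [Z | NZ].
  { exists 0, hzero. split; [rewrite Z; hring |]. split; [| auto].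
    intros x. rewrite Z, nsq_zero. lra. }
  apply not_all_ex_not in NZ. destruct NZ as [x0 Hx0].
  destruct (bounded_nsq A BO) as [K [PK HK]].
  destruct (completeness (fun r => exists x, nsq x <= 1 /\ r = nsq (A x))) as [m [U LU]].
  { exists K. intros r [x [Hx ->]]. specialize (HK x). nra. }
  { exists (nsq (A hzero)), hzero. rewrite nsq_zero. split; [lra | reflexivity]. }
  assert (forall x, nsq (A x) <= m * nsq x) as HB.
  { intros x. destruct (classic (x = hzero)) as [-> | N].
    - rewrite (linear_zero A L), nsq_zero. lra.
    - destruct (exists_unit_multiple x N) as [r [Pr [Hr Ur]]].
      assert (nsq (A (hscal (RtoC r) x)) <= m) as Q.
      { apply U. eexists. split; [| reflexivity]. unfold nsq. rewrite Ur. simpl. lra. }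
      rewrite (proj2 L), nsq_scal in Q. unfold csq, RtoC in Q. simpl fst in Q; simpl snd in Q.
      replace (r ^ 2 + 0 ^ 2) with (r ^ 2) in Q by ring.
      replace (nsq (A x)) with (r ^ 2 * nsq (A x) * nsq x)
        by (transitivity (nsq (A x) * (r ^ 2 * nsq x)); [ring | rewrite Hr; ring]).
      apply Rmult_le_compat_r; [apply nsq_ge0 | exact Q]. }
  assert (0 < m) as Pm.
  { apply Rnot_le_lt. intro. apply Hx0, nsq_eq0. specialize (HB x0).
    pose proof (nsq_ge0 x0). nra. }
  destruct (sqr_eigenvector A m CO SA Pm HB) as [y [Ny Hy]].
  { intros eps He. apply NNPP. intro N. assert (m <= m - eps); [| lra].
    apply LU. intros r [x [Hx ->]]. apply Rnot_lt_le. intro. apply N. eauto. }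
  assert (forall t e, t ^ 2 = m -> e <> hzero -> A e = hscal (RtoC t) e ->
    exists t e, A e = hscal (RtoC t) e /\ (forall x, nsq (A x) <= t ^ 2 * nsq x) /\
    (t = 0 /\ e = hzero \/ t <> 0 /\ hip e e = C1)) as FIN.
  { intros t e Ht Ne He. destruct (exists_unit_multiple e Ne) as [r [Pr [_ Ur]]].
    exists t, (hscal (RtoC r) e). split; [| split].
    - rewrite (proj2 L), He. hring.
    - intro x. rewrite Ht. apply HB.
    - right. split; [| exact Ur]. intros ->. lra. }
  assert (sqrt m ^ 2 = m) as SM by (apply pow2_sqrt; lra).
  destruct (classic (hadd (A y) (hscal (RtoC (sqrt m)) y) = hzero)) as [Z | NZ].
  - apply (FIN (- sqrt m) y); [nra | exact Ny |].
    apply hsub_eq0. rewrite <- Z. hring.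
  - apply (FIN (sqrt m) (hadd (A y) (hscal (RtoC (sqrt m)) y))); auto.
    rewrite (proj1 L), (proj2 L), Hy.
    replace m with (sqrt m * sqrt m) at 1 by lra. hring.
Qed.

(** * Deflation and the sequence of eigenvectors *)

Definition project_out {H : Hilb} (e x : H) : H := hsub H x (hscal (hip x e) e).

Lemma nsq_project_out {H : Hilb} (e x : H) :
  e = hzero \/ hip e e = C1 -> nsq (project_out e x) <= nsq x.
Proof.
  intros He. unfold project_out. rewrite nsq_sub, nsq_scal, hip_scalr.
  assert (nsq e <= 1) as N.
  { destruct He as [-> | U]; [rewrite nsq_zero; lra | unfold nsq; rewrite U; simpl; lra]. }
  pose proof (csq_ge0 (hip x e)).
  replace (fst (Cmul (Cconj (hip x e)) (hip x e))) with (csq (hip x e))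
    by (unfold csq; simpl; ring).
  nra.
Qed.

Lemma project_out_orth {H : Hilb} (e x : H) : hip x e = C0 -> project_out e x = x.
Proof. intros Z. unfold project_out. rewrite Z. hring. Qed.

Lemma deflate_compact {H : Hilb} (A : H -> H) e :
  e = hzero \/ hip e e = C1 -> compact_op H A -> compact_op H (fun x => A (project_out e x)).
Proof.
  intros He [BO CO]. pose proof BO as [[LA LS] _]. split.
  - destruct (bounded_nsq A BO) as [K [PK HK]].
    apply (bounded_of_nsq _ K); [lra | |].
    + split.
      * intros x y. rewrite <- LA. f_equal. unfold project_out. hring.
      * intros a x. rewrite <- LS. f_equal. unfold project_out. hring.
    + intros x. specialize (HK (project_out e x)). pose proof (nsq_project_out e x He). nra.
  - intros u [M HM]. apply (CO (fun n => project_out e (u n))). exists M. intro n.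
    apply Rle_trans with (hnorm H (u n)); [| auto].
    apply sqrt_le_1_alt, nsq_project_out, He.
Qed.

(** Since [e] is an eigenvector with a real eigenvalue, the correction to <A x, y> is t <x, e> <e,
    y>, which is Hermitian in x and y. *)
Lemma deflate_self_adjoint {H : Hilb} (A : H -> H) e t :
  linear_op H A -> self_adjoint H A -> A e = hscal (RtoC t) e ->
  self_adjoint H (fun x => A (project_out e x)).
Proof.
  intros L SA He x y. unfold project_out. rewrite !linear_sub, !(proj2 L), He by auto.
  unfold hsub. autorewrite with hip. rewrite SA, (hip_conj _ y e).
  cring.
Qed.

Lemma spectral_sequence {H : Hilb} (T : H -> H) :
  compact_op H T -> self_adjoint H T ->
  exists (t : nat -> R) (e : nat -> H),
    (forall n, t n = 0 /\ e n = hzero \/ t n <> 0 /\ hip (e n) (e n) = C1) /\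
    (forall i j, i <> j -> hip (e i) (e j) = C0) /\
    (forall n, T (e n) = hscal (RtoC (t n)) (e n)) /\
    (forall n, Rabs (t (S n)) <= Rabs (t n)) /\
    (forall x, (forall n, hip x (e n) = C0) -> forall n, nsq (T x) <= t n ^ 2 * nsq x).
Proof.
  intros CO SA.
  (* The two properties travel with the operator, so that [choice] gives total functions [pick] and
     [next] and the construction is plain iteration. *)
  pose (St := {A : H -> H | compact_op H A /\ self_adjoint H A}).
  destruct (choice (fun (A : St) (te : R * H) =>
    proj1_sig A (snd te) = hscal (RtoC (fst te)) (snd te) /\
    (forall x, nsq (proj1_sig A x) <= fst te ^ 2 * nsq x) /\
    (fst te = 0 /\ snd te = hzero \/ fst te <> 0 /\ hip (snd te) (snd te) = C1)))
    as [pick Hpick].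
  { intros [A [CA SAA]]. destruct (compact_top_eigenvector A CA SAA) as [t [e Hte]].
    exists (t, e). exact Hte. }
  assert (forall A : St, exists B : St, forall x,
    proj1_sig B x = proj1_sig A (project_out (snd (pick A)) x)) as NX.
  { intros A. destruct (Hpick A) as [E1 [_ E3]]. destruct (proj2_sig A) as [CA SAA].
    assert (compact_op H (fun x => proj1_sig A (project_out (snd (pick A)) x)) /\
      self_adjoint H (fun x => proj1_sig A (project_out (snd (pick A)) x))) as CS.
    { split; [apply deflate_compact; tauto |].
      eapply deflate_self_adjoint; eauto. apply CA. }
    exists (exist _ (fun x => proj1_sig A (project_out (snd (pick A)) x)) CS).
    reflexivity. }
  destruct (choice _ NX) as [next Hnext].
  pose (A := fun n => Nat.iter n next
    (exist (fun A => compact_op H A /\ self_adjoint H A) T (conj CO SA))).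
  pose (t := fun n => fst (pick (A n))). pose (e := fun n => snd (pick (A n))).
  assert (forall n, proj1_sig (A n) (e n) = hscal (RtoC (t n)) (e n)) as Ee
    by (intro; apply Hpick).
  assert (forall n x, nsq (proj1_sig (A n) x) <= t n ^ 2 * nsq x) as Eb
    by (intro; apply Hpick).
  assert (forall n, t n = 0 /\ e n = hzero \/ t n <> 0 /\ hip (e n) (e n) = C1) as Eu
    by (intro; apply Hpick).
  assert (forall n x, proj1_sig (A (S n)) x = proj1_sig (A n) (project_out (e n) x)) as EA
    by (intros; apply Hnext).
  assert (forall n, self_adjoint H (proj1_sig (A n))) as ES
    by (intro n; apply (proj2_sig (A n))).
  assert (forall n, linear_op H (proj1_sig (A n))) as EL
    by (intro n; apply (proj2_sig (A n))).
  (* By self-adjointness an eigenvector for a nonzero eigenvalue is orthogonal to the kernel; a null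
     [e n] is orthogonal to everything. *)
  assert (forall n z, proj1_sig (A n) z = hzero -> hip (e n) z = C0) as EO.
  { intros n z Hz. destruct (Eu n) as [[_ Z] | [Nt _]].
    - rewrite Z. apply hip_zero_l.
    - pose proof (ES n (e n) z) as Q. rewrite Ee, Hz, hip_zero_r, hip_scal in Q.
      apply Cmul_eq0 in Q. destruct Q as [Q | Q]; [| exact Q].
      unfold RtoC, C0 in Q. injection Q; intros; contradiction. }
  assert (forall n k, (k < n)%nat -> proj1_sig (A n) (e k) = hzero) as EZ.
  { induction n as [| n IH]; intros k Hk; [lia |]. rewrite EA.
    destruct (Nat.eq_dec k n) as [-> | Nk].
    - replace (project_out (e n) (e n)) with (@hzero H); [apply linear_zero, EL |].
      unfold project_out. destruct (Eu n) as [[_ Z] | [_ U]].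
      + rewrite Z. hring.
      + rewrite U. hring.
    - assert (proj1_sig (A n) (e k) = hzero) as Z by (apply IH; lia).
      rewrite project_out_orth; [exact Z |]. rewrite hip_conj, (EO n _ Z). cring. }
  assert (forall i j, (j < i)%nat -> hip (e i) (e j) = C0) as EO2.
  { intros i j Hij. apply EO, EZ, Hij. }
  assert (forall i j, i <> j -> hip (e i) (e j) = C0) as EO3.
  { intros i j Hij. destruct (Nat.lt_ge_cases j i) as [Q | Q]; [auto |].
    rewrite hip_conj, EO2 by lia. cring. }
  (* On vectors orthogonal to the earlier [e k] no deflation has any effect; this carries statements
     about [A n] over to [T]. *)
  assert (forall n x, (forall k, (k < n)%nat -> hip x (e k) = C0) ->
    proj1_sig (A n) x = T x) as ET.
  { induction n as [| n IH]; intros x Hx; [reflexivity |].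
    rewrite EA, project_out_orth by (apply Hx; lia). apply IH. intros. apply Hx. lia. }
  exists t, e. repeat split; auto.
  - intro n. rewrite <- Ee. symmetry. apply ET. intros k Hk. apply EO2, Hk.
  - intro n. destruct (Eu (S n)) as [[Z _] | [_ U]].
    + rewrite Z, Rabs_R0. apply Rabs_pos.
    + apply Rsqr_le_abs_0. unfold Rsqr.
      (* [A (S n)] is [A n] after a projection, so the bound of [A n] also limits the next
         eigenvalue. *)
      pose proof (Eb n (project_out (e n) (e (S n)))) as Q. rewrite <- EA, Ee, nsq_scal in Q.
      assert (nsq (e (S n)) = 1) as U1 by (unfold nsq; rewrite U; reflexivity).
      assert (nsq (project_out (e n) (e (S n))) <= 1) as U2.
      { rewrite <- U1. apply nsq_project_out. specialize (Eu n). tauto. }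
      rewrite U1 in Q. unfold csq, RtoC in Q. simpl fst in Q; simpl snd in Q.
      pose proof (nsq_ge0 (project_out (e n) (e (S n)))). nra.
  - intros x Hx n. rewrite <- (ET n) by auto. apply Eb.
Qed.

Lemma nonincreasing_le (u : nat -> R) : (forall n, u (S n) <= u n) ->
  forall m n, (m <= n)%nat -> u n <= u m.
Proof. intros D m n Hmn. induction Hmn; [lra |]. specialize (D m0). lra. Qed.

(** If all |t_n| were at least eps, the images T e_n would be pairwise orthogonal of norm at least
    eps, and no subsequence of them could be Cauchy. Monotonicity turns one small value into a small
    tail. *)
Lemma eigenvalues_vanish {H : Hilb} (T : H -> H) (t : nat -> R) (e : nat -> H) :
  compact_op H T ->
  (forall n, t n = 0 /\ e n = hzero \/ t n <> 0 /\ hip (e n) (e n) = C1) ->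
  (forall i j, i <> j -> hip (e i) (e j) = C0) ->
  (forall n, T (e n) = hscal (RtoC (t n)) (e n)) ->
  (forall n, Rabs (t (S n)) <= Rabs (t n)) ->
  forall eps, 0 < eps -> exists N, forall n, (N <= n)%nat -> Rabs (t n) < eps.
Proof.
  intros [_ CO] Eu Eo Et Ed eps He. apply NNPP. intro N.
  assert (forall n, eps <= Rabs (t n)) as G.
  { intro n. apply Rnot_lt_le. intro Q. apply N. exists n. intros k Hk.
    apply Rle_lt_trans with (Rabs (t n)); [| exact Q].
    apply (nonincreasing_le (fun n => Rabs (t n))); auto. }
  assert (forall n, nsq (e n) = 1) as U.
  { intro n. destruct (Eu n) as [[Z _] | [_ U]].
    - specialize (G n). rewrite Z, Rabs_R0 in G. lra.
    - unfold nsq. rewrite U. reflexivity. }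
  destruct (CO e) as [phi [Hphi [y Hy]]].
  { exists 1. intro n. unfold hnorm. change (fst (hip (e n) (e n))) with (nsq (e n)).
    rewrite U, sqrt_1. lra. }
  destruct (converges_cauchy _ _ Hy (eps ^ 2)) as [M HM]; [nra |].
  specialize (HM M (S M) (Nat.le_refl _) (Nat.le_succ_diag_r _)).
  rewrite !Et, nsq_sub, !nsq_scal, !U, hip_scal, hip_scalr, Eo in HM
    by (specialize (Hphi M); lia).
  assert (forall n, eps ^ 2 <= csq (RtoC (t n))) as G2.
  { intro n. unfold csq, RtoC. simpl fst; simpl snd. specialize (G n).
    rewrite <- (pow2_abs (t n)). nra. }
  pose proof (G2 (phi M)). pose proof (G2 (phi (S M))).
  unfold C0, Cmul in HM. simpl in HM. nra.
Qed.

(** * Orthonormal bases of eigenvectors *)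

(** A closed subspace, encoded by what is needed of closedness: every vector has an orthogonal
    projection [r] onto [V]. *)
Definition projectable {H : Hilb} (V : H -> Prop) : Prop :=
  (forall x y, V x -> V y -> V (hsub H x y)) /\
  (forall a x, V x -> V (hscal a x)) /\
  (forall x, exists r, V r /\ forall z, V z -> hip r z = hip x z).

(** One Gram-Schmidt step inside [V]: [g] is the normalised projection of [d], and members of [V]
    cannot distinguish [d] from its projection. A null projection is passed on as [hzero]. *)
Lemma projectable_unit_vector {H : Hilb} (V : H -> Prop) d : projectable V ->
  exists g, V g /\ (g = hzero \/ hip g g = C1) /\
    forall z, V z -> hip z g = C0 -> hip z d = C0.
Proof.
  intros [_ [VS VP]]. destruct (VP d) as [r [Vr Hr]].
  assert (forall z, V z -> hip z d = hip z r) as Hr2.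
  { intros z Vz. rewrite hip_conj, <- (Hr z Vz), <- hip_conj. reflexivity. }
  destruct (classic (r = hzero)) as [-> | N].
  - exists hzero. repeat split; auto. intros z Vz Hz. rewrite Hr2; auto.
  - destruct (exists_unit_multiple r N) as [a [Pa [_ Ua]]].
    exists (hscal (RtoC a) r). repeat split; auto.
    intros z Vz Hz. rewrite Hr2 by auto. rewrite hip_scalr in Hz.
    apply Cmul_eq0 in Hz. destruct Hz as [Hz | Hz]; [| exact Hz].
    unfold Cconj, RtoC, C0 in Hz. simpl in Hz. injection Hz; lra.
Qed.

Lemma projectable_cut {H : Hilb} (V : H -> Prop) g : projectable V -> V g ->
  (g = hzero \/ hip g g = C1) -> projectable (fun z => V z /\ hip z g = C0).
Proof.
  intros [VA [VS VP]] Vg Ug. split; [| split].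
  - intros x y [Vx Hx] [Vy Hy]. split; [auto |]. unfold hsub. autorewrite with hip.
    rewrite Hx, Hy. cring.
  - intros a x [Vx Hx]. split; [auto |]. rewrite hip_scal, Hx. cring.
  - intros x. destruct (VP x) as [r [Vr Hr]]. exists (project_out g r).
    unfold project_out. split; [split |].
    + apply VA; auto.
    + unfold hsub. autorewrite with hip. destruct Ug as [-> | U].
      * rewrite !hip_zero_r. cring.
      * rewrite U. cring.
    + intros z [Vz Hz]. rewrite <- (Hr z Vz). unfold hsub. autorewrite with hip.
      rewrite (hip_conj _ z g), Hz. cring.
Qed.

(** The projection is x - y, where [y] is the Fourier series of [x] along [e]; [y] is a limit of
    finite combinations of the [e i], hence orthogonal to the complement. *)
Lemma orthocomplement_projectable {H : Hilb} {I : Type} (e : I -> H) :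
  orthofam e -> projectable (fun z => forall k, hip z (e k) = C0).
Proof.
  intros O. split; [| split].
  - intros x y Hx Hy k. unfold hsub. autorewrite with hip. rewrite Hx, Hy. cring.
  - intros a x Hx k. rewrite hip_scal, Hx. cring.
  - intros x.
    destruct (riesz_fischer e (fun i => hip x (e i)) (nsq x)) as [y [Cy Ay]]; auto.
    + apply supported_hip.
    + intros. apply bessel; auto.
    + exists (hsub H x y). split.
      * intro k. unfold hsub. autorewrite with hip. rewrite Cy. cring.
      * intros z Hz. assert (hip y z = C0) as Q.
        { apply csq_eq0, (arbitrarily_small _ (nsq z)). intros eps He.
          destruct (Ay eps He) as [l [_ Hl]].
          assert (hip (fourier_sum e (fun i => hip x (e i)) l) z = C0) as Z.
          { unfold fourier_sum. clear Hl. induction l as [| i l IH]; simpl.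
            - apply hip_zero_l.
            - autorewrite with hip. rewrite IH, (hip_conj _ z (e i)), Hz. cring. }
          pose proof (cauchy_schwarz
            (hsub H y (fourier_sum e (fun i => hip x (e i)) l)) z) as CS.
          unfold hsub in CS at 1. autorewrite with hip in CS. rewrite Z in CS.
          replace (Cadd (hip y z) (Cmul (RtoC (-1)) C0)) with (hip y z) in CS by cring.
          pose proof (nsq_ge0 z). nra. }
        unfold hsub. autorewrite with hip. rewrite Q. cring.
Qed.

Lemma dense_orthogonal_zero {H : Hilb} (d : nat -> H) z :
  (forall (x : H) eps, 0 < eps -> exists n, hnorm H (hsub H x (d n)) < eps) ->
  (forall n, hip z (d n) = C0) -> z = hzero.
Proof.
  intros D Hz. apply nsq_eq0, (arbitrarily_small _ 1). intros eps He.
  destruct (D z (sqrt eps) (sqrt_lt_R0 _ He)) as [n Hn].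
  apply hnorm_lt_sqrt in Hn; [| exact He]. rewrite nsq_sub, Hz in Hn. simpl in Hn.
  pose proof (nsq_ge0 (d n)). lra.
Qed.

(** Gram-Schmidt on a dense sequence [d], inside the decreasing subspaces [V n] of the complement of
    [e]. A vector orthogonal to all [e k] and [g n] lies in every [V n], hence is orthogonal to
    every [d n]. *)
Lemma complete_orthofam {H : Hilb} {I : Type} (e : I -> H) :
  separable H -> orthofam e ->
  exists g : nat -> H, orthofam g /\ (forall n k, hip (g n) (e k) = C0) /\
    forall x, (forall k, hip x (e k) = C0) -> (forall n, hip x (g n) = C0) -> x = hzero.
Proof.
  intros [d D] O. pose (St := {V : H -> Prop | projectable V}).
  destruct (choice (fun (nV : nat * St) g => proj1_sig (snd nV) g /\
    (g = hzero \/ hip g g = C1) /\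
    forall z, proj1_sig (snd nV) z -> hip z g = C0 -> hip z (d (fst nV)) = C0))
    as [pick Hpick].
  { intros [n V]. apply projectable_unit_vector, (proj2_sig V). }
  assert (forall nV : nat * St, exists W : St, forall z,
    proj1_sig W z <-> proj1_sig (snd nV) z /\ hip z (pick nV) = C0) as NX.
  { intros nV. destruct (Hpick nV) as [P1 [P2 _]].
    exists (exist _ _ (projectable_cut _ _ (proj2_sig (snd nV)) P1 P2)).
    simpl. tauto. }
  destruct (choice _ NX) as [next Hnext].
  pose (V := fun n => nat_rect (fun _ => St)
    (exist _ _ (orthocomplement_projectable e O)) (fun n W => next (n, W)) n).
  pose (g := fun n => pick (n, V n)).
  assert (forall n z, proj1_sig (V (S n)) z <->
    proj1_sig (V n) z /\ hip z (g n) = C0) as VS by (intros; apply Hnext).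
  assert (forall n, proj1_sig (V n) (g n)) as Vg by (intro n; apply (Hpick (n, V n))).
  assert (forall n z, proj1_sig (V n) z <->
    (forall k, hip z (e k) = C0) /\ forall k, (k < n)%nat -> hip z (g k) = C0) as VC.
  { induction n as [| n IH]; intro z.
    - simpl. split; [| tauto]. intro Q. split; [exact Q | lia].
    - rewrite VS, IH. split.
      + intros [[Q1 Q2] Q3]. split; [exact Q1 |]. intros k Hk.
        destruct (Nat.eq_dec k n) as [-> | Nk]; [exact Q3 | apply Q2; lia].
      + intros [Q1 Q2]. repeat split; auto. }
  exists g. repeat split.
  - assert (forall i j, (j < i)%nat -> hip (g i) (g j) = C0) as G.
    { intros i j Hij. apply (VC i); auto. }
    intros i j Hij. destruct (Nat.lt_ge_cases j i) as [Q | Q]; [auto |].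
    rewrite hip_conj, G by lia. cring.
  - intro n. apply (Hpick (n, V n)).
  - intros n. apply (VC n). auto.
  - intros x He Hg. apply (dense_orthogonal_zero d); auto. intro n.
    apply (Hpick (n, V n)); [| apply Hg]. apply VC. auto.
Qed.

(* [nu i] is the rank of [|tau i|] in [lam] (junk if [tau i = 0]); [lam] is padded
   with zeros. *)
Definition eigensystem {H : Hilb} {I : Type} (T : H -> H)
    (E : I -> H) (tau : I -> R) (nu : I -> nat) (lam : nat -> R) : Prop :=
  ONB H E /\
  (forall i, T (E i) = hscal (RtoC (tau i)) (E i)) /\
  (forall i j, tau i <> 0 -> tau j <> 0 -> nu i = nu j -> i = j) /\
  (forall i, tau i <> 0 -> lam (nu i) = Rabs (tau i)) /\
  (forall n, lam n <> 0 -> exists i, tau i <> 0 /\ nu i = n) /\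
  (forall n, 0 <= lam n) /\
  (forall n, lam (S n) <= lam n) /\
  (forall eps, 0 < eps -> exists N, forall n, (N <= n)%nat -> lam n < eps).

Lemma spectral_theorem {H : Hilb} (T : H -> H) :
  separable H -> compact_op H T -> self_adjoint H T ->
  exists (I : Type) (E : I -> H) (tau : I -> R) (nu : I -> nat) (lam : nat -> R),
    countable I /\ eigensystem T E tau nu lam.
Proof.
  intros Hsep CO SA.
  destruct (spectral_sequence T CO SA) as [t [e [Eu [Eo [Et [Ed Ek]]]]]].
  pose proof (eigenvalues_vanish T t e CO Eu Eo Et Ed) as Ev.
  assert (orthofam e) as Oe by (split; [exact Eo |]; intro n; specialize (Eu n); tauto).
  destruct (complete_orthofam e Hsep Oe) as [g [Og [Oge Tot]]].
  (* As [g n] is orthogonal to all [e k], |T g_n| <= |t_N| |g_n| for every N, and t_N tends to 0. *)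
  assert (forall n, T (g n) = hzero) as Tg.
  { intro n. apply nsq_eq0, (arbitrarily_small _ (nsq (g n))). intros eps He.
    destruct (Ev (sqrt eps) (sqrt_lt_R0 _ He)) as [N HN].
    specialize (HN N (Nat.le_refl _)). specialize (Ek (g n) (Oge n) N).
    rewrite <- pow2_abs in Ek. pose proof (Rabs_pos (t N)).
    pose proof (pow2_sqrt eps (Rlt_le _ _ He)). pose proof (nsq_ge0 (g n)).
    assert (Rabs (t N) ^ 2 <= eps) by nra. nra. }
  pose (F := fun i : nat + nat => match i with inl n => e n | inr n => g n end).
  pose (s := fun i : nat + nat => match i with inl n => t n | inr n => 0 end).
  pose (w := fun i : nat + nat => match i with inl n => n | inr n => n end).
  (* The left copy of [nat] carries the eigenvectors split off, the right one the kernel vectors.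
     The subtype discards the null vectors used as padding on both sides. *)
  exists {i : nat + nat | F i <> hzero}, (fun i => F (proj1_sig i)),
    (fun i => s (proj1_sig i)), (fun i => w (proj1_sig i)), (fun n => Rabs (t n)).
  assert (forall i j : {i : nat + nat | F i <> hzero}, proj1_sig i = proj1_sig j -> i = j)
    as INJ.
  { intros [i Hi] [j Hj] Q. simpl in Q. subst j. f_equal. apply proof_irrelevance. }
  split; [| split; [split; [| split] |]].
  - exists (fun i => match proj1_sig i with inl n => 2 * n | inr n => 2 * n + 1 end)%nat.
    intros i j Q. apply INJ. destruct (proj1_sig i), (proj1_sig j); f_equal; lia.
  - intros [[n | n] Hi]; simpl in *.
    + destruct (Eu n); tauto.
    + destruct (proj2 Og n); tauto.
  - intros i j Hij. assert (proj1_sig i <> proj1_sig j) as N by auto.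
    destruct (proj1_sig i) as [n | n], (proj1_sig j) as [m | m]; simpl.
    + apply Eo. congruence.
    + rewrite hip_conj, Oge. cring.
    + apply Oge.
    + apply Og. congruence.
  - intros x Hx. assert (forall i, hip x (F i) = C0) as Hx2.
    { intro i. destruct (classic (F i = hzero)) as [Z | N].
      - rewrite Z. apply hip_zero_r.
      - apply (Hx (exist _ i N)). }
    apply Tot; intro n; [apply (Hx2 (inl n)) | apply (Hx2 (inr n))].
  - repeat split.
    + intros i. destruct (proj1_sig i) as [n | n]; simpl; [apply Et |].
      rewrite Tg. hring.
    + intros i j Hi Hj Q. apply INJ.
      destruct (proj1_sig i), (proj1_sig j); simpl in *; congruence || tauto.
    + intros i Hi. destruct (proj1_sig i); simpl in *; tauto.
    + intros n Hn. assert (t n <> 0) as Nt.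
      { intro Z. apply Hn. rewrite Z. apply Rabs_R0. }
      assert (F (inl n) <> hzero) as NF.
      { simpl. intro Z. destruct (Eu n) as [[Q _] | [_ U]]; [tauto |].
        rewrite Z, hip_zero_l in U. unfold C0, C1 in U. injection U; lra. }
      exists (exist _ (inl n) NF). simpl. auto.
    + intro. apply Rabs_pos.
    + exact Ed.
    + exact Ev.
Qed.

(** * Diagonal operators in an orthonormal basis *)

Lemma hip_eigenvector {H : Hilb} (T : H -> H) x e r : self_adjoint H T ->
  T e = hscal (RtoC r) e -> hip (T x) e = Cmul (RtoC r) (hip x e).
Proof. intros SA He. rewrite SA, He, hip_scalr. cring. Qed.

Lemma csq_RtoC r : csq (RtoC r) = r ^ 2.
Proof. unfold csq, RtoC. simpl. ring. Qed.

(** [riesz_fischer] defines [D x] by its coefficients, Parseval's identity bounds it, and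
    self-adjointness, checked on finite Fourier sums, extends by density. *)
Lemma diagonal_operator {H : Hilb} {I : Type} (E : I -> H) (a : I -> R) M :
  ONB H E -> (forall i, Rabs (a i) <= M) ->
  exists D : H -> H, bounded_op H D /\ self_adjoint H D /\
    forall x i, hip (D x) (E i) = Cmul (RtoC (a i)) (hip x (E i)).
Proof.
  intros O HM. pose proof (ONB_orthofam E O) as OF.
  assert (forall x l, NoDup l ->
    lsum l (fun i => csq (Cmul (RtoC (a i)) (hip x (E i)))) <= M ^ 2 * nsq x) as HB.
  { intros x l ND. apply Rle_trans with (M ^ 2 * lsum l (fun i => csq (hip x (E i)))).
    - rewrite <- lsum_scal. apply lsum_le. intros i _. rewrite csq_mul, csq_RtoC.
      apply Rmult_le_compat_r; [apply csq_ge0 |]. rewrite <- pow2_abs.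
      apply pow_incr. split; [apply Rabs_pos | auto].
    - apply Rmult_le_compat_l; [nra | apply bessel; auto]. }
  destruct (choice (fun x y => forall i, hip y (E i) = Cmul (RtoC (a i)) (hip x (E i))))
    as [D HD].
  { intro x.
    destruct (riesz_fischer E (fun i => Cmul (RtoC (a i)) (hip x (E i))) (M ^ 2 * nsq x))
      as [y [Cy _]]; eauto using ONB_supported. }
  assert (linear_op H D) as L.
  { split; intros; apply (ONB_ext E _ _ O); intro i; rewrite ?HD; autorewrite with hip;
      rewrite !HD; cring. }
  assert (forall x, nsq (D x) <= M ^ 2 * nsq x) as BD.
  { intro x. apply (parseval_identity E (D x) O). intros r [l [ND ->]].
    rewrite (lsum_ext l _ (fun i => csq (Cmul (RtoC (a i)) (hip x (E i))))); auto.
    intros. rewrite HD. reflexivity. }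
  assert (forall i, D (E i) = hscal (RtoC (a i)) (E i)) as DE.
  { intro i. apply (ONB_ext E _ _ O). intro j. rewrite HD, hip_scal.
    destruct (classic (i = j)) as [-> | N]; [reflexivity |].
    rewrite (proj1 (proj2 O)) by auto. cring. }
  exists D. split; [| split; [| exact HD]].
  - apply (bounded_of_nsq D (M ^ 2)); auto. nra.
  - intros x y.
    assert (csq (Cadd (hip (D x) y) (Cmul (RtoC (-1)) (hip x (D y)))) <= 0) as Z.
    { apply (arbitrarily_small _ (4 * M ^ 2 * nsq y)). intros eps He.
      destruct (ONB_dense E x eps O He) as [l [ND Hl]].
      set (S := fourier_sum E (fun i => hip x (E i)) l) in *.
      assert (hip (D S) y = hip S (D y)) as Q.
      { unfold S, fourier_sum. clear - L DE HD.
        rewrite linear_vsum by auto. induction l as [| i l IH]; simpl.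
        - rewrite !hip_zero_l. reflexivity.
        - rewrite !hip_add, IH, (proj2 L), DE. autorewrite with hip.
          rewrite (hip_conj _ (D y) (E i)), HD, (hip_conj _ y (E i)). cring. }
      pose proof (cauchy_schwarz (D (hsub H x S)) y) as C1'.
      pose proof (cauchy_schwarz (hsub H x S) (D y)) as C2'.
      pose proof (BD (hsub H x S)) as B1. pose proof (BD y) as B2.
      pose proof (nsq_ge0 y). pose proof (nsq_ge0 (hsub H x S)).
      assert (nsq (D (hsub H x S)) * nsq y <= M ^ 2 * nsq y * eps) as K1.
      { apply Rle_trans with (M ^ 2 * nsq (hsub H x S) * nsq y); [nra |].
        replace (M ^ 2 * nsq (hsub H x S) * nsq y)
          with (M ^ 2 * nsq y * nsq (hsub H x S)) by ring.
        apply Rmult_le_compat_l; [| lra]. apply Rmult_le_pos; [nra | lra]. }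
      assert (nsq (hsub H x S) * nsq (D y) <= M ^ 2 * nsq y * eps) as K2.
      { apply Rle_trans with (nsq (hsub H x S) * (M ^ 2 * nsq y)); [nra |].
        rewrite Rmult_comm. apply Rmult_le_compat_l; [| lra].
        apply Rmult_le_pos; [nra | lra]. }
      rewrite (linear_sub D) in C1' by auto. unfold hsub in C1' at 1, C2' at 1.
      autorewrite with hip in C1', C2'. rewrite Q in C1'.
      set (u := hip (D x) y) in *. set (v := hip x (D y)) in *. set (q := hip S (D y)) in *.
      assert (csq (Cadd u (Cmul (RtoC (-1)) q)) <= M ^ 2 * nsq y * eps) as C1''.
      { rewrite (linear_sub D) in K1 by auto. lra. }
      assert (csq (Cadd v (Cmul (RtoC (-1)) q)) <= M ^ 2 * nsq y * eps) as C2'' by lra.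
      clear - C1'' C2''. unfold csq, Cadd, Cmul, RtoC in *. simpl in *.
      pose proof (pow2_ge_0 ((fst u - fst q) + (fst v - fst q))).
      pose proof (pow2_ge_0 ((snd u - snd q) + (snd v - snd q))).
      nra. }
    apply csq_eq0 in Z. unfold Cadd, Cmul, RtoC, C0 in Z. simpl in Z. injection Z; intros.
    apply injective_projections; lra.
Qed.

(** Positivity comes from the diagonal operator [Q] with entries sqrt(a_i): D = Q^2, so <D x, x> =
    |Q x|^2. *)
Lemma positive_diagonal_operator {H : Hilb} {I : Type} (E : I -> H) (a : I -> R) M :
  ONB H E -> (forall i, 0 <= a i <= M) ->
  exists D : H -> H, bounded_op H D /\ self_adjoint H D /\
    (forall x, 0 <= fst (hip (D x) x)) /\
    forall x i, hip (D x) (E i) = Cmul (RtoC (a i)) (hip x (E i)).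
Proof.
  intros O Ha.
  destruct (diagonal_operator E a M O) as [D [BD [SD HD]]].
  { intro i. rewrite Rabs_pos_eq; apply Ha. }
  destruct (diagonal_operator E (fun i => sqrt (a i)) (sqrt M) O) as [Q [BQ [SQ HQ]]].
  { intro i. rewrite Rabs_pos_eq by apply sqrt_pos. apply sqrt_le_1_alt, Ha. }
  exists D. repeat split; auto; try apply BD.
  intro x. replace (D x) with (Q (Q x)).
  - rewrite SQ. apply hip_pos.
  - apply (ONB_ext E _ _ O). intro i. rewrite !HQ, HD.
    pose proof (sqrt_sqrt (a i) (proj1 (Ha i))) as Q2.
    set (r := sqrt (a i)) in *. rewrite <- Q2. cring.
Qed.

(** * Multiplicities and singular values *)

Lemma vsum_map {H : Hilb} {I J : Type} (g : I -> J) (l : list I) (u : J -> H) :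
  vsum (map g l) u = vsum l (fun i => u (g i)).
Proof. induction l; simpl; congruence. Qed.

Lemma vsum_ext {H : Hilb} {I : Type} (l : list I) (u v : I -> H) :
  (forall i, In i l -> u i = v i) -> vsum l u = vsum l v.
Proof.
  induction l as [| i l IH]; simpl; intros E; [reflexivity |]. rewrite E, IH; auto.
Qed.

Definition list_family {H : Hilb} (l : list H) (i : nat) : H := nth i l hzero.

Lemma lincomb_vsum {H : Hilb} (l : list H) c :
  lincomb H l c = fourier_sum (list_family l) c (seq 0 (length l)).
Proof.
  unfold fourier_sum, list_family. revert c.
  induction l as [| v l IH]; intro c; simpl; [reflexivity |].
  rewrite IH, <- seq_shift, vsum_map. reflexivity.
Qed.

Lemma orthonormal_list_unit {H : Hilb} (l : list H) i :
  orthonormal_list H l -> (i < length l)%nat -> nsq (list_family l i) = 1.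
Proof.
  intros O Hi. unfold nsq, list_family. rewrite O, Nat.eqb_refl by auto. reflexivity.
Qed.

Lemma orthonormal_list_orthofam {H : Hilb} (l : list H) :
  orthonormal_list H l -> orthofam (list_family l).
Proof.
  intros O. unfold list_family. split.
  - intros i j N.
    destruct (Nat.lt_ge_cases i (length l)) as [Hi | Hi];
      [| rewrite (nth_overflow l hzero Hi); apply hip_zero_l].
    destruct (Nat.lt_ge_cases j (length l)) as [Hj | Hj];
      [| rewrite (nth_overflow l hzero Hj); apply hip_zero_r].
    rewrite O by auto. apply Nat.eqb_neq in N. rewrite N. reflexivity.
  - intro i. destruct (Nat.lt_ge_cases i (length l)) as [Hi | Hi].
    + right. rewrite O, Nat.eqb_refl by auto. reflexivity.
    + left. apply nth_overflow, Hi.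
Qed.

Lemma in_span_nsq {H : Hilb} (l : list H) x : orthonormal_list H l -> in_span H l x ->
  nsq x = lsum (seq 0 (length l)) (fun i => csq (hip x (list_family l i))).
Proof.
  intros O [c ->]. rewrite lincomb_vsum.
  (* [list_family l] is null beyond the length of [l], so [supported] forces the coefficients there
     to be cut to 0. *)
  pose (c' := fun i => if lt_dec i (length l) then c i else C0).
  assert (supported (list_family l) c') as S.
  { intros i Z. unfold c'. destruct (lt_dec i (length l)) as [Hi |]; [| reflexivity].
    pose proof (orthonormal_list_unit l i O Hi) as U. rewrite Z, nsq_zero in U. lra. }
  replace (fourier_sum (list_family l) c (seq 0 (length l)))
    with (fourier_sum (list_family l) c' (seq 0 (length l))).
  - pose proof (orthonormal_list_orthofam l O) as OF.
    rewrite nsq_fourier_sum by (auto using seq_NoDup).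
    apply lsum_ext. intros i Hi. rewrite fourier_coef_in by (auto using seq_NoDup).
    reflexivity.
  - apply vsum_ext. intros i Hi. apply in_seq in Hi. unfold c'.
    destruct (lt_dec i (length l)); [reflexivity | lia].
Qed.

Lemma in_span_nth {H : Hilb} (l : list H) i : (i < length l)%nat ->
  in_span H l (list_family l i).
Proof.
  unfold list_family. revert i. induction l as [| v l IH]; simpl; intros i Hi; [lia |].
  destruct i as [| i].
  - exists (fun n => match n with O => C1 | S _ => C0 end). simpl.
    assert (lincomb H l (fun _ => C0) = hzero) as ->.
    { clear. induction l; simpl; [reflexivity |]. rewrite IHl. hring. }
    hring.
  - destruct (IH i) as [c Hc]; [lia |].
    exists (fun n => match n with O => C0 | S n => c n end). simpl.
    change (fun n : nat => c n) with c. rewrite Hc at 1. hring.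
Qed.

(* Both lengths are the double sum of [|<u_i, v_j>|^2], up to Bessel. *)
Lemma orthonormal_length_le {H : Hilb} (l l' : list H) :
  orthonormal_list H l -> orthonormal_list H l' ->
  (forall x, in_span H l x -> in_span H l' x) -> (length l <= length l')%nat.
Proof.
  intros O O' S. apply INR_le.
  pose (D := lsum (seq 0 (length l)) (fun i => lsum (seq 0 (length l'))
    (fun j => csq (hip (list_family l i) (list_family l' j))))).
  assert (D = INR (length l)) as E1.
  { unfold D. rewrite (lsum_ext _ _ (fun _ => 1)).
    - rewrite lsum_const, length_seq. ring.
    - intros i Hi. apply in_seq in Hi. rewrite <- in_span_nsq; auto.
      + apply orthonormal_list_unit; [auto | lia].
      + apply S, in_span_nth. lia. }
  assert (D <= INR (length l')) as E2.
  { unfold D. rewrite lsum_swap.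
    apply Rle_trans with (lsum (seq 0 (length l')) (fun _ => 1)).
    - apply lsum_le. intros j Hj. apply in_seq in Hj.
      rewrite <- (orthonormal_list_unit l' j) by (auto; lia).
      rewrite (lsum_ext _ _ (fun i => csq (hip (list_family l' j) (list_family l i)))).
      + apply bessel; [apply orthonormal_list_orthofam; auto | apply seq_NoDup].
      + intros i _. rewrite hip_conj, csq_conj. reflexivity.
    - rewrite lsum_const, length_seq. lra. }
  lra.
Qed.

Lemma eig_mult_unique {H : Hilb} (Q : H -> H) mu m m' :
  eig_mult H Q mu m -> eig_mult H Q mu m' -> m = m'.
Proof.
  intros [l [<- [O S]]] [l' [<- [O' S']]].
  apply Nat.le_antisymm; apply orthonormal_length_le; auto; intros x Hx.
  - apply S', S, Hx.
  - apply S, S', Hx.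
Qed.

Lemma count_val_unique (lam : nat -> R) mu m m' :
  count_val lam mu m -> count_val lam mu m' -> m = m'.
Proof.
  intros [l [ND [<- S]]] [l' [ND' [<- S']]].
  apply Nat.le_antisymm; apply NoDup_incl_length; auto; intros n Hn.
  - apply S', S, Hn.
  - apply S, S', Hn.
Qed.

(** From (Q + mu)(Q - mu) x = 0, the vector y = (Q - mu) x satisfies Q y = -mu y, and positivity of
    [Q] forces y = 0. *)
Lemma pos_sqrt_eigenspace {H : Hilb} (T Q : H -> H) mu x :
  pos_sqrt H Q (fun x => T (T x)) -> 0 < mu ->
  (Q x = hscal (RtoC mu) x <-> T (T x) = hscal (RtoC (mu ^ 2)) x).
Proof.
  intros [[[QA QS] _] [_ [QP QQ]]] Pm. split; intros E.
  - rewrite <- QQ, E, QS, E. hring.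
  - pose (y := hsub H (Q x) (hscal (RtoC mu) x)).
    assert (Q y = hscal (RtoC (- mu)) y) as Ey.
    { unfold y. rewrite linear_sub, QS, QQ, E by (split; assumption). hring. }
    apply hsub_eq0, nsq_eq0. fold y.
    pose proof (QP y) as P. rewrite Ey, hip_scal, hip_self in P.
    unfold Cmul, RtoC in P. simpl in P. pose proof (nsq_ge0 y). nra.
Qed.

Lemma vsum_in_span {H : Hilb} {I : Type} (E : I -> H) (c : I -> Defs.C) l :
  in_span H (map E l) (fourier_sum E c l).
Proof.
  unfold fourier_sum. induction l as [| i l [c' Hc']].
  - exists (fun _ => C0). reflexivity.
  - exists (fun n => match n with O => c i | S n => c' n end). simpl.
    rewrite Hc'. reflexivity.
Qed.

Lemma span_linear {H : Hilb} (A B : H -> H) l x : linear_op H A -> linear_op H B ->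
  (forall v, In v l -> A v = B v) -> in_span H l x -> A x = B x.
Proof.
  intros LA LB. revert x. induction l as [| v l IH]; intros x HV [c ->]; simpl.
  - rewrite !linear_zero by auto. reflexivity.
  - rewrite (proj1 LA), (proj1 LB), (proj2 LA), (proj2 LB), HV by (left; reflexivity).
    f_equal. apply IH; [intros; apply HV; right; assumption |]. eexists. reflexivity.
Qed.

Lemma orthonormal_map {H : Hilb} {I : Type} (E : I -> H) l : ONB H E -> NoDup l ->
  orthonormal_list H (map E l).
Proof.
  intros [U [O _]] ND i j Hi Hj. rewrite length_map in *.
  destruct l as [| d l]; [simpl in Hi; lia |].
  rewrite !(nth_indep (map E (d :: l)) hzero (E d)) by (rewrite length_map; auto).
  rewrite !map_nth. destruct (Nat.eqb_spec i j) as [-> | N]; [apply U |].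
  apply O. intro Q. apply N. apply (proj1 (NoDup_nth (d :: l) d) ND); auto.
Qed.

Lemma scal_linear {H : Hilb} a : linear_op H (hscal a).
Proof. split; intros; hring. Qed.

Lemma comp_linear {H : Hilb} (A B : H -> H) : linear_op H A -> linear_op H B ->
  linear_op H (fun x => A (B x)).
Proof.
  intros [A1 A2] [B1 B2]. split; intros.
  - rewrite B1, A1. reflexivity.
  - rewrite B2, A2. reflexivity.
Qed.

Lemma lift_eigenvalue_list {H : Hilb} {I : Type} (T : H -> H) (E : I -> H) tau nu lam ln :
  eigensystem T E tau nu lam -> (forall n, In n ln -> lam n <> 0) ->
  exists l, map nu l = ln /\ forall i, In i l -> tau i <> 0.
Proof.
  intros [_ [_ [_ [_ [SU _]]]]]. induction ln as [| n ln IH]; intros HN.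
  - exists nil. split; [reflexivity | simpl; tauto].
  - destruct IH as [l [El Hl]]; [intros; apply HN; right; assumption |].
    destruct (SU n) as [i [Hi Ei]]; [apply HN; left; reflexivity |].
    exists (i :: l). split; [simpl; congruence |].
    intros j [<- | Hj]; auto.
Qed.

(** Since [lam] tends to 0, the value [mu] occurs finitely often; [nu] matches its positions with
    the [E i] for which |tau_i| = mu, and these span the eigenspace. With uniqueness of both counts,
    a common [m] gives the equivalence in [sing_vals]. *)
Lemma eig_mult_count {H : Hilb} {I : Type} (T Q : H -> H) (E : I -> H) tau nu lam mu :
  eigensystem T E tau nu lam -> linear_op H T -> self_adjoint H T ->
  pos_sqrt H Q (fun x => T (T x)) -> 0 < mu ->
  exists m, eig_mult H Q mu m /\ count_val lam mu m.
Proof.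
  intros ES L SA PS Pm.
  pose proof ES as [O [ET [INJ [LN [_ [_ [_ VAN]]]]]]].
  destruct (VAN mu Pm) as [N HN].
  pose (ln := filter (fun n => if Req_dec_T (lam n) mu then true else false) (seq 0 N)).
  assert (forall n, In n ln <-> lam n = mu) as Hln.
  { intro n. unfold ln. rewrite filter_In, in_seq.
    destruct (Req_dec_T (lam n) mu) as [Q1 | Q1]; split; intros Q2;
      try tauto; try (destruct Q2; congruence).
    split; [| reflexivity]. split; [lia |]. simpl. apply Nat.nle_gt. intro Q3.
    specialize (HN n Q3). lra. }
  assert (NoDup ln) as ND by (apply NoDup_filter, seq_NoDup).
  destruct (lift_eigenvalue_list T E tau nu lam ln ES) as [l [El Hl]].
  { intros n Hn. apply Hln in Hn. lra. }
  assert (NoDup l) as NDl by (apply (NoDup_map_inv nu); rewrite El; exact ND).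
  assert (forall i, In i l <-> Rabs (tau i) = mu) as Hil.
  { intro i. split; intro Hi.
    - rewrite <- LN by auto. apply Hln. rewrite <- El. apply in_map, Hi.
    - assert (tau i <> 0) as Ni by (intros Z; rewrite Z, Rabs_R0 in Hi; lra).
      assert (In (nu i) ln) as Q1 by (apply Hln; rewrite LN; auto).
      rewrite <- El in Q1. apply in_map_iff in Q1. destruct Q1 as [j [Ej Hj]].
      rewrite <- (INJ j i); auto. }
  exists (length ln). split; [| exists ln; auto].
  exists (map E l). split; [rewrite length_map, <- El, length_map; reflexivity |].
  split; [apply orthonormal_map; auto |].
  intro x. rewrite (pos_sqrt_eigenspace T Q mu x PS Pm). split; intros Hx.
  - assert (forall i, Rabs (tau i) <> mu -> hip x (E i) = C0) as Z.
    { intros i Ni. pose proof (hip_eigenvector T (T x) (E i) (tau i) SA (ET i)) as Q1.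
      rewrite (hip_eigenvector T x (E i) (tau i) SA (ET i)), Hx, hip_scal in Q1.
      (* Comparing coefficients of T^2 x = mu^2 x at [E i]: they vanish unless |tau_i| = mu. *)
      assert (Cmul (RtoC (mu ^ 2 - tau i ^ 2)) (hip x (E i)) = C0) as Q2.
      { unfold Cmul, RtoC, C0 in *. simpl in *. injection Q1; intros.
        apply injective_projections; simpl; lra. }
      apply Cmul_eq0 in Q2. destruct Q2 as [Q2 | Q2]; [| exact Q2].
      exfalso. unfold RtoC, C0 in Q2. injection Q2; intros. apply Ni.
      rewrite <- pow2_abs in *. pose proof (Rabs_pos (tau i)).
      assert (mu * mu = Rabs (tau i) * Rabs (tau i)) by (rewrite <- Rabs_mult, Rabs_pos_eq; nra).
      nra. }
    rewrite (ONB_ext E x (fourier_sum E (fun i => hip x (E i)) l) O);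
      [apply vsum_in_span |].
    pose proof (ONB_orthofam E O) as OF. intro i.
    destruct (classic (In i l)) as [Hi | Hi].
    + rewrite fourier_coef_in; auto. apply supported_hip.
    + rewrite fourier_coef_out; auto. apply Z. rewrite <- Hil. exact Hi.
  - apply (span_linear (fun x => T (T x)) (hscal (RtoC (mu ^ 2))) (map E l)); auto.
    + apply comp_linear; auto.
    + apply scal_linear.
    + intros v Hv. apply in_map_iff in Hv. destruct Hv as [i [<- Hi]].
      rewrite ET, (proj2 L), ET. apply Hil in Hi. rewrite <- Hi, pow2_abs. hring.
Qed.

(** If a_n > b_n, monotonicity puts every position where [b] takes the value a_n before n. There [a]
    agrees with [b], so [a] takes this value once more, at n itself. *)
Lemma nonincreasing_counts_le (a b : nat -> R) n :
  (forall n, 0 <= b n) -> (forall n, b (S n) <= b n) ->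
  (forall mu, 0 < mu -> exists m, count_val a mu m /\ count_val b mu m) ->
  (forall k, (k < n)%nat -> a k = b k) -> a n <= b n.
Proof.
  intros Pb Db C IH. apply Rnot_lt_le. intro Q.
  destruct (C (a n)) as [m [[l [NDl [Ll Hl]]] [l' [NDl' [Ll' Hl']]]]];
    [specialize (Pb n); lra |].
  assert (forall k, In k l' -> (k < n)%nat) as LT.
  { intros k Hk. apply Hl' in Hk. apply Nat.nle_gt. intro Q2.
    pose proof (nonincreasing_le b Db n k Q2). lra. }
  assert (S (length l') <= length l)%nat as F; [| lia].
  change (length (n :: l') <= length l)%nat. apply NoDup_incl_length.
  - constructor; auto. intro Q2. specialize (LT n Q2). lia.
  - intros k [<- | Hk]; apply Hl; [reflexivity |].
    rewrite IH by auto. apply Hl', Hk.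
Qed.

Lemma nonincreasing_determined_by_counts (a b : nat -> R) :
  (forall n, 0 <= a n) -> (forall n, 0 <= b n) ->
  (forall n, a (S n) <= a n) -> (forall n, b (S n) <= b n) ->
  (forall mu, 0 < mu -> exists m, count_val a mu m /\ count_val b mu m) ->
  forall n, a n = b n.
Proof.
  intros Pa Pb Da Db C n. induction n as [n IH] using (well_founded_induction lt_wf).
  apply Rle_antisym.
  - apply nonincreasing_counts_le; auto.
  - apply nonincreasing_counts_le; auto.
    + intros mu Pm. destruct (C mu Pm) as [m [C1 C2]]. eauto.
    + intros. symmetry. auto.
Qed.

Lemma adjoint_of_self_adjoint {H : Hilb} (T Ta : H -> H) :
  self_adjoint H T -> is_adjoint H T Ta -> forall x, Ta x = T x.
Proof.
  intros SA AD x. apply hip_ext. intro z.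
  rewrite (hip_conj _ z (Ta x)), (hip_conj _ z (T x)), <- AD, SA. reflexivity.
Qed.

(** The required square root of T^2 is the diagonal operator with entries |tau_i|, bounded because
    |tau_i| = |T E_i|. *)
Lemma eigensystem_sing_vals {H : Hilb} {I : Type} (T : H -> H) (E : I -> H) tau nu lam :
  bounded_op H T -> self_adjoint H T -> eigensystem T E tau nu lam -> sing_vals H T lam.
Proof.
  intros BO SA ES. pose proof ES as [O [ET [_ [_ [_ [P [D _]]]]]]].
  destruct (bounded_nsq T BO) as [K [PK HK]].
  destruct (positive_diagonal_operator E (fun i => Rabs (tau i)) (sqrt K) O)
    as [Q [BQ [SQ [PQ HQ]]]].
  { intro i. split; [apply Rabs_pos |]. rewrite <- (sqrt_pow2 (Rabs (tau i))) by apply Rabs_pos.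
    apply sqrt_le_1_alt. rewrite pow2_abs. specialize (HK (E i)).
    rewrite ET, nsq_scal, csq_RtoC in HK. unfold nsq in HK. rewrite (proj1 O) in HK.
    simpl fst in HK. lra. }
  assert (pos_sqrt H Q (fun x => T (T x))) as PS.
  { repeat split; auto; try apply BQ. intro x. apply (ONB_ext E _ _ O). intro i.
    rewrite !HQ, !(hip_eigenvector T _ (E i) (tau i)) by auto.
    assert (Rabs (tau i) * Rabs (tau i) = tau i * tau i) as Q2
      by (rewrite <- Rabs_mult; apply Rabs_pos_eq; nra).
    unfold Cmul, RtoC. apply injective_projections; simpl; ring [Q2]. }
  exists T, Q. do 4 (split; [assumption |]). intros mu Pm m.
  destruct (eig_mult_count T Q E tau nu lam mu) as [k [K1 K2]]; auto; [apply BO |].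
  split; intro M.
  - rewrite (eig_mult_unique _ _ _ _ M K1). exact K2.
  - rewrite (count_val_unique _ _ _ _ M K2). exact K1.
Qed.

(** [In_Sp] and [Sp_normp] only assert the existence of some sequence of singular values; this
    identifies any such sequence with the one read off the eigenbasis. *)
Lemma sing_vals_eigensystem {H : Hilb} {I : Type} (T : H -> H) (E : I -> H) tau nu lam lam' :
  linear_op H T -> self_adjoint H T -> eigensystem T E tau nu lam -> sing_vals H T lam' ->
  forall n, lam' n = lam n.
Proof.
  intros L SA ES [Ta [Q [AD [PS [P' [D' C']]]]]].
  assert (pos_sqrt H Q (fun x => T (T x))) as PS2.
  { destruct PS as [Q1 [Q2 [Q3 Q4]]]. repeat split; auto; try apply Q1.
    intro x. rewrite Q4. apply adjoint_of_self_adjoint; auto. }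
  pose proof ES as [_ [_ [_ [_ [_ [P [D _]]]]]]].
  apply nonincreasing_determined_by_counts; auto.
  intros mu Pm. destruct (eig_mult_count T Q E tau nu lam mu) as [k [K1 K2]]; auto.
  exists k. split; [| exact K2]. apply C'; auto.
Qed.

(** * Series of singular values and sums over the eigenbasis *)

Lemma sum_f_R0_lsum (b : nat -> R) N : sum_f_R0 b N = lsum (seq 0 (S N)) b.
Proof.
  induction N as [| N IH]; [simpl; ring |].
  rewrite seq_S, lsum_app, <- IH. simpl. ring.
Qed.

Lemma rpow_0 p : rpow 0 p = 0.
Proof. unfold rpow. destruct (Rle_dec 0 0); lra. Qed.

Lemma rpow_ge0 x p : 0 <= rpow x p.
Proof. unfold rpow. destruct (Rle_dec x 0); [lra |]. unfold Rpower. apply Rlt_le, exp_pos. Qed.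

(** Zero eigenvalues, where [nu] is junk, are split off first; they contribute nothing by [rpow_0].
    On the others [nu] is injective. *)
Lemma lsum_eigenvalues_le {H : Hilb} {I : Type} (T : H -> H) (E : I -> H) tau nu lam p l :
  eigensystem T E tau nu lam -> NoDup l ->
  exists N, lsum l (fun i => rpow (Rabs (tau i)) p) <= sum_f_R0 (fun n => rpow (lam n) p) N.
Proof.
  intros [_ [_ [INJ [LN _]]]] ND.
  rewrite (lsum_split_pred (fun i => tau i <> 0)).
  set (b := fun i => if excluded_middle_informative (tau i <> 0) then true else false).
  assert (forall i, b i = true <-> tau i <> 0) as Hb.
  { intro i. unfold b. destruct (excluded_middle_informative (tau i <> 0)); split; intro;
      tauto || discriminate. }
  rewrite (lsum_eq0 (filter (fun i => negb (b i)) l)).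
  2: { intros i Hi. apply filter_In in Hi. destruct Hi as [_ Hi].
       destruct (Req_dec (tau i) 0) as [-> | N]; [rewrite Rabs_R0; apply rpow_0 |].
       apply Hb in N. rewrite N in Hi. discriminate. }
  assert (NoDup (map nu (filter b l))) as ND2.
  { assert (forall i, In i (filter b l) -> tau i <> 0) as Q.
    { intros i Hi. apply filter_In in Hi. apply Hb, Hi. }
    assert (NoDup (filter b l)) as ND1 by (apply NoDup_filter, ND).
    apply NoDup_map_NoDup_ForallPairs; [| exact ND1].
    intros i j Hi Hj. apply INJ; auto. }
  exists (list_max (map nu (filter b l))). rewrite sum_f_R0_lsum.
  rewrite Rplus_0_r, (lsum_ext _ _ (fun i => rpow (lam (nu i)) p)).
  - rewrite <- (lsum_map nu _ (fun n => rpow (lam n) p)). apply lsum_incl; auto.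
    + intro. apply rpow_ge0.
    + intros n Hn. apply in_seq. split; [lia |]. simpl. apply Nat.lt_succ_r.
      pose proof (proj1 (list_max_le (map nu (filter b l)) _) (Nat.le_refl _)) as F.
      rewrite Forall_forall in F. apply F, Hn.
  - intros i Hi. apply filter_In in Hi. rewrite LN; [reflexivity | apply Hb, Hi].
Qed.

Lemma partial_sum_le_lsum {H : Hilb} {I : Type} (T : H -> H) (E : I -> H) tau nu lam p N :
  eigensystem T E tau nu lam ->
  exists l, NoDup l /\
    sum_f_R0 (fun n => rpow (lam n) p) N <= lsum l (fun i => rpow (Rabs (tau i)) p).
Proof.
  intros ES. pose proof ES as [_ [_ [_ [LN _]]]].
  rewrite sum_f_R0_lsum, (lsum_split_pred (fun n => lam n <> 0)).
  set (b := fun n => if excluded_middle_informative (lam n <> 0) then true else false).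
  rewrite (lsum_eq0 (filter (fun i => negb (b i)) _)).
  2: { intros n Hn. apply filter_In in Hn. destruct Hn as [_ Hn]. unfold b in Hn.
       destruct (excluded_middle_informative (lam n <> 0)) as [| Q]; [discriminate |].
       apply NNPP in Q. rewrite Q. apply rpow_0. }
  destruct (lift_eigenvalue_list T E tau nu lam (filter b (seq 0 (S N))) ES) as [l [El Hl]].
  { intros n Hn. apply filter_In in Hn. destruct Hn as [_ Hn]. unfold b in Hn.
    destruct (excluded_middle_informative (lam n <> 0)); [assumption | discriminate]. }
  exists l. split.
  - apply (NoDup_map_inv nu). rewrite El. apply NoDup_filter, seq_NoDup.
  - rewrite <- El, lsum_map, Rplus_0_r. apply lsum_le. intros i Hi.
    rewrite LN by auto. lra.
Qed.

Lemma usum_of_infinite_sum {H : Hilb} {I : Type} (T : H -> H) (E : I -> H) tau nu lam p v :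
  eigensystem T E tau nu lam -> infinite_sum (fun n => rpow (lam n) p) v ->
  usum (fun i => rpow (Rabs (tau i)) p) v.
Proof.
  intros ES IS. split.
  - intros r [l [ND ->]].
    destruct (lsum_eigenvalues_le T E tau nu lam p l ES ND) as [N HN].
    apply Rle_trans with (1 := HN). apply sum_incr; [exact IS |]. intro. apply rpow_ge0.
  - intros b Hb. apply Rnot_lt_le. intro Q. destruct (IS (v - b)) as [N HN]; [lra |].
    specialize (HN N (Nat.le_refl _)).
    destruct (partial_sum_le_lsum T E tau nu lam p N ES) as [l [ND Hl]].
    assert (lsum l (fun i => rpow (Rabs (tau i)) p) <= b) by (apply Hb; eauto).
    unfold Rdist in HN. apply Rabs_def2 in HN. lra.
Qed.

Lemma infinite_sum_of_bounded {H : Hilb} {I : Type} (T : H -> H) (E : I -> H) tau nu lam p B :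
  eigensystem T E tau nu lam ->
  (forall l, NoDup l -> lsum l (fun i => rpow (Rabs (tau i)) p) <= B) ->
  exists s, infinite_sum (fun n => rpow (lam n) p) s.
Proof.
  intros ES HB.
  destruct (growing_cv (sum_f_R0 (fun n => rpow (lam n) p))) as [s Hs].
  - intro n. simpl. pose proof (rpow_ge0 (lam (S n)) p). lra.
  - exists B. intros r [N ->].
    destruct (partial_sum_le_lsum T E tau nu lam p N ES) as [l [ND Hl]].
    specialize (HB l ND). lra.
  - exists s. exact Hs.
Qed.

(** * Real powers *)

Lemma rpow_pos x q : 0 < x -> rpow x q = exp (q * ln x).
Proof. intros P. unfold rpow. destruct (Rle_dec x 0); [lra | reflexivity]. Qed.

Lemma rpow_1 q : rpow 1 q = 1.
Proof. rewrite rpow_pos by lra. rewrite ln_1, Rmult_0_r. apply exp_0. Qed.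

Lemma rpow_mult x y q : 0 <= x -> 0 <= y -> rpow (x * y) q = rpow x q * rpow y q.
Proof.
  intros [Px | <-] [Py | <-]; rewrite ?Rmult_0_l, ?Rmult_0_r, ?rpow_0; try ring.
  rewrite !rpow_pos by (auto using Rmult_lt_0_compat).
  rewrite ln_mult, <- exp_plus by auto. f_equal. ring.
Qed.

Lemma rpow_rpow x q r : 0 <= x -> rpow (rpow x q) r = rpow x (q * r).
Proof.
  intros [Px | <-]; [| rewrite !rpow_0; reflexivity].
  rewrite (rpow_pos x q), (rpow_pos x (q * r)) by auto.
  rewrite rpow_pos by apply exp_pos. rewrite ln_exp. f_equal. ring.
Qed.

Lemma rpow_exp1 x : 0 <= x -> rpow x 1 = x.
Proof.
  intros [Px | <-]; [| apply rpow_0]. rewrite rpow_pos, Rmult_1_l by auto. apply exp_ln, Px.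
Qed.

Lemma rpow_sqr x q : 0 <= x -> rpow (x ^ 2) q = rpow x (2 * q).
Proof.
  intros Px. simpl. rewrite Rmult_1_r, rpow_mult by auto.
  destruct Px as [Px | <-]; [| rewrite !rpow_0; ring].
  rewrite !rpow_pos, <- exp_plus by auto. f_equal. ring.
Qed.

Lemma rpow_le x y q : 0 <= q -> 0 <= x <= y -> rpow x q <= rpow y q.
Proof.
  intros Pq [[Px | <-] [L | <-]]; try lra.
  - rewrite !rpow_pos by lra. pose proof (ln_increasing x y Px L).
    assert (q * ln x <= q * ln y) as [Q | ->] by (apply Rmult_le_compat_l; lra); [| lra].
    apply Rlt_le, exp_increasing, Q.
  - rewrite rpow_0. apply rpow_ge0.
Qed.

Lemma rpow_ge_self x q : 0 < q <= 1 -> 0 <= x <= 1 -> x <= rpow x q.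
Proof.
  intros Pq [[Px | <-] L]; [| rewrite rpow_0; lra].
  replace x with (rpow x q * rpow x (1 - q)) at 1.
  - pose proof (rpow_ge0 x q).
    pose proof (rpow_le x 1 (1 - q)) as L1. rewrite rpow_1 in L1.
    assert (rpow x (1 - q) <= 1) by (apply L1; lra). nra.
  - rewrite !rpow_pos, <- exp_plus by auto.
    replace (q * ln x + (1 - q) * ln x) with (ln x) by ring. apply exp_ln, Px.
Qed.

(* Both [exp L] and [1] are compared with the tangent line of [exp] at [q L]. *)
Lemma rpow_bernoulli x q : 0 < q <= 1 -> 0 <= x -> rpow x q <= q * x + (1 - q).
Proof.
  intros Pq [Px | <-]; [| rewrite rpow_0; lra].
  rewrite rpow_pos by auto. rewrite <- (exp_ln x) at 2 by auto.
  set (L := ln x).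
  assert (exp L = exp (q * L) * exp ((1 - q) * L)) as E1
    by (rewrite <- exp_plus; f_equal; ring).
  assert (1 = exp (q * L) * exp (- (q * L))) as E2
    by (rewrite <- exp_plus, Rplus_opp_r, exp_0; reflexivity).
  pose proof (exp_ineq1_le ((1 - q) * L)). pose proof (exp_ineq1_le (- (q * L))).
  pose proof (exp_pos (q * L)).
  assert (exp (q * L) * (1 + (1 - q) * L) <= exp L) by (rewrite E1; apply Rmult_le_compat_l; lra).
  assert (exp (q * L) * (1 + - (q * L)) <= 1) by (rewrite E2 at 2; apply Rmult_le_compat_l; lra).
  nra.
Qed.

(** For z = x and z = y, the ratio z/(x+y) lies in [0, 1] and is at most its q-th power; multiply by
    (x+y)^q and add. *)
Lemma rpow_subadditive x y q : 0 < q <= 1 -> 0 <= x -> 0 <= y ->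
  rpow (x + y) q <= rpow x q + rpow y q.
Proof.
  intros Pq Px Py. destruct (Rle_lt_dec (x + y) 0) as [Z | Z].
  - replace (x + y) with 0 by lra. rewrite rpow_0.
    pose proof (rpow_ge0 x q). pose proof (rpow_ge0 y q). lra.
  - assert (forall z, 0 <= z <= x + y -> rpow (x + y) q * (z / (x + y)) <= rpow z q) as K.
    { intros z Hz.
      assert (0 <= z / (x + y) <= 1) as B.
      { split; [apply Rmult_le_pos; [lra | apply Rlt_le, Rinv_0_lt_compat, Z] |].
        apply Rmult_le_reg_r with (x + y); [exact Z |]. field_simplify; lra. }
      replace z with ((x + y) * (z / (x + y))) at 2 by (field; lra).
      rewrite rpow_mult by lra. apply Rmult_le_compat_l; [apply rpow_ge0 |].
      apply rpow_ge_self; auto. }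
    pose proof (K x ltac:(lra)). pose proof (K y ltac:(lra)).
    replace (rpow (x + y) q) with
      (rpow (x + y) q * (x / (x + y)) + rpow (x + y) q * (y / (x + y))) by (field; lra).
    lra.
Qed.

Lemma rpow_lsum_le {I : Type} (l : list I) a q : 0 < q <= 1 -> (forall i, 0 <= a i) ->
  rpow (lsum l a) q <= lsum l (fun i => rpow (a i) q).
Proof.
  intros Pq Pa. induction l as [| i l IH]; simpl; [rewrite rpow_0; lra |].
  pose proof (rpow_subadditive (a i) (lsum l a) q Pq (Pa i) (lsum_ge0 l a Pa)). lra.
Qed.

(** Each u_i^q is bounded by the tangent of t^q at t = A/B. The bound is linear in u_i, so summing
    it needs only the two hypotheses on sums, and q = 1 requires no separate treatment. *)
Lemma rpow_holder {I : Type} (l : list I) (w u : I -> R) A B q : 0 < q <= 1 ->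
  (forall i, 0 <= w i) -> (forall i, 0 <= u i) ->
  lsum l (fun i => w i * u i) <= A -> lsum l w <= B ->
  lsum l (fun i => w i * rpow (u i) q) <= rpow A q * rpow B (1 - q).
Proof.
  intros Pq Pw Pu HA HB.
  (* When B or A is not positive the quotient A/B is of no use, but then every term on the left
     vanishes. *)
  destruct (Rle_lt_dec B 0) as [ZB | PB].
  { rewrite lsum_eq0.
    - apply Rmult_le_pos; apply rpow_ge0.
    - intros i Hi. pose proof (lsum_term_le l w i Pw Hi). specialize (Pw i).
      replace (w i) with 0 by lra. ring. }
  destruct (Rle_lt_dec A 0) as [ZA | PA].
  { rewrite lsum_eq0.
    - apply Rmult_le_pos; apply rpow_ge0.
    - intros i Hi.
      assert (forall i, 0 <= w i * u i) as Pwu by (intro; apply Rmult_le_pos; auto).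
      pose proof (lsum_term_le l (fun i => w i * u i) i Pwu Hi) as Q. simpl in Q.
      specialize (Pwu i). assert (w i * u i = 0) as Z by lra.
      apply Rmult_integral in Z. destruct Z as [-> | ->]; [| rewrite rpow_0]; ring. }
  assert (0 < A / B) as PAB by (apply Rdiv_lt_0_compat; auto).
  apply Rle_trans with (rpow (A / B) q * (q * (B / A) * lsum l (fun i => w i * u i)
    + (1 - q) * lsum l w)).
  - rewrite <- !lsum_scal, <- lsum_plus, <- lsum_scal. apply lsum_le. intros i _.
    assert (0 <= u i * (B / A)) as P2.
    { apply Rmult_le_pos; [auto |]. apply Rlt_le, Rdiv_lt_0_compat; auto. }
    replace (u i) with (A / B * (u i * (B / A))) at 1 by (field; lra).
    rewrite rpow_mult by lra. pose proof (rpow_bernoulli _ q Pq P2).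
    pose proof (rpow_ge0 (A / B) q). specialize (Pw i).
    apply Rle_trans with (rpow (A / B) q * (w i * (q * (u i * (B / A)) + (1 - q)))).
    + rewrite (Rmult_comm (w i)), Rmult_assoc. apply Rmult_le_compat_l; [auto |].
      rewrite Rmult_comm. apply Rmult_le_compat_l; auto.
    + apply Req_le. ring.
  - apply Rle_trans with (rpow (A / B) q * B).
    + apply Rmult_le_compat_l; [apply rpow_ge0 |].
      apply Rle_trans with (q * (B / A) * A + (1 - q) * B).
      * apply Rplus_le_compat; apply Rmult_le_compat_l; auto; [| lra].
        apply Rmult_le_pos; [lra |]. apply Rlt_le, Rdiv_lt_0_compat; auto.
      * apply Req_le. field. lra.
    + apply Req_le. rewrite !rpow_pos by auto. rewrite <- (exp_ln B) at 2 by auto.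
      rewrite <- !exp_plus. f_equal. unfold Rdiv.
      rewrite ln_mult, ln_Rinv by (auto using Rinv_0_lt_compat). ring.
Qed.

(** * Hilbert-Schmidt operators are compact *)

(** Subsequences are represented by infinite sets of indices, so that refining one is inclusion
    rather than composition. *)
Definition infinite_set (A : nat -> Prop) : Prop := forall N, exists n, (N <= n)%nat /\ A n.

Lemma infinite_set_split (A P : nat -> Prop) : infinite_set A ->
  infinite_set (fun n => A n /\ P n) \/ infinite_set (fun n => A n /\ ~ P n).
Proof.
  intros IA. apply NNPP. intro Q. apply not_or_and in Q. destruct Q as [Q1 Q2].
  apply not_all_ex_not in Q1. destruct Q1 as [N1 Q1].
  apply not_all_ex_not in Q2. destruct Q2 as [N2 Q2].
  destruct (IA (Nat.max N1 N2)) as [n [Hn An]].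
  destruct (classic (P n)).
  - apply Q1. exists n. split; [lia | auto].
  - apply Q2. exists n. split; [lia | auto].
Qed.

(** Pigeonhole, by induction on the number [k] of cells of length [d]: either the top cell holds
    infinitely many indices or the remaining ones do. *)
Lemma infinite_set_refine_interval (r : nat -> R) lo d k : 0 < d -> forall A, infinite_set A ->
  (forall n, A n -> lo <= r n <= lo + INR k * d) ->
  exists B : nat -> Prop, infinite_set B /\ (forall n, B n -> A n) /\
    forall a b, B a -> B b -> Rabs (r a - r b) <= d.
Proof.
  intros Pd. induction k as [| k IH]; intros A IA HA.
  - exists A. repeat split; auto. intros a b Ha Hb.
    pose proof (HA a Ha). pose proof (HA b Hb). simpl in *. apply Rabs_le. lra.
  - destruct (infinite_set_split A (fun n => r n <= lo + INR k * d) IA) as [I1 | I1].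
    + destruct (IH _ I1) as [B [IB [SB HB]]].
      * intros n [An Q]. split; [apply HA, An | exact Q].
      * exists B. repeat split; auto. intros n Bn. apply SB, Bn.
    + exists (fun n => A n /\ ~ r n <= lo + INR k * d). repeat split; auto; [tauto |].
      intros a b [Aa Qa] [Ab Qb]. rewrite S_INR in HA.
      pose proof (HA a Aa). pose proof (HA b Ab). apply Rabs_le. lra.
Qed.

Lemma Rabs_le_inv a b : Rabs a <= b -> - b <= a <= b.
Proof.
  intros L. pose proof (Rle_abs a). pose proof (Rle_abs (- a)) as Q. rewrite Rabs_Ropp in Q.
  lra.
Qed.

Lemma infinite_set_refine_real (r : nat -> R) M d A : 0 < d -> (forall n, Rabs (r n) <= M) ->
  infinite_set A -> exists B : nat -> Prop, infinite_set B /\ (forall n, B n -> A n) /\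
    forall a b, B a -> B b -> Rabs (r a - r b) <= d.
Proof.
  intros Pd HM IA. destruct (INR_unbounded (2 * M / d)) as [k Hk].
  apply (infinite_set_refine_interval r (- M) d k Pd A IA). intros n _.
  specialize (HM n). apply Rabs_le_inv in HM. split; [lra |].
  apply Rmult_lt_compat_r with (r := d) in Hk; [| exact Pd].
  replace (2 * M / d * d) with (2 * M) in Hk by (field; lra). lra.
Qed.

Lemma infinite_set_refine_list {J : Type} (z : J -> nat -> Defs.C) (M : J -> R) d (l : list J) A :
  0 < d -> (forall j n, csq (z j n) <= M j) -> infinite_set A ->
  exists B : nat -> Prop, infinite_set B /\ (forall n, B n -> A n) /\
    forall j a b, In j l -> B a -> B b ->
      csq (Cadd (z j a) (Cmul (RtoC (-1)) (z j b))) <= d.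
Proof.
  intros Pd HM IA. induction l as [| j l IH].
  - exists A. repeat split; auto. simpl. tauto.
  - destruct IH as [B [IB [SB HB]]].
    (* Real and imaginary parts each contribute at most d/2 to the squared distance. *)
    pose (d' := sqrt (d / 2)).
    assert (0 < d') as Pd' by (apply sqrt_lt_R0; lra).
    assert (d' ^ 2 = d / 2) as Ed by (apply pow2_sqrt; lra).
    assert (forall n, Rabs (fst (z j n)) <= M j + 1 /\ Rabs (snd (z j n)) <= M j + 1) as HF.
    { intro n. specialize (HM j n). unfold csq in HM. split; apply Rabs_le; nra. }
    destruct (infinite_set_refine_real (fun n => fst (z j n)) (M j + 1) d' B Pd')
      as [B1 [IB1 [SB1 HB1]]]; [apply HF | exact IB |].
    destruct (infinite_set_refine_real (fun n => snd (z j n)) (M j + 1) d' B1 Pd')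
      as [B2 [IB2 [SB2 HB2]]]; [apply HF | exact IB1 |].
    exists B2. split; [exact IB2 |]. split; [auto |].
    intros k a b [<- | Hk] Ba Bb; [| auto].
    pose proof (HB1 a b (SB2 _ Ba) (SB2 _ Bb)) as Q1. pose proof (HB2 a b Ba Bb) as Q2.
    apply Rabs_le_inv in Q1. apply Rabs_le_inv in Q2.
    unfold csq, Cadd, Cmul, RtoC. simpl fst; simpl snd. nra.
Qed.

(** Diagonal extraction: step k shrinks the infinite set to squared diameter at most 1/(k+1) and
    picks in it an index larger than the previous one. The sets are nested, so later picks remain in
    them. *)
Lemma cauchy_subsequence {H : Hilb} (u : nat -> H) :
  (forall A eps, infinite_set A -> 0 < eps -> exists B : nat -> Prop,
     infinite_set B /\ (forall n, B n -> A n) /\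
     forall a b, B a -> B b -> nsq (hsub H (u a) (u b)) <= eps) ->
  exists phi : nat -> nat, (forall n, (phi n < phi (S n))%nat) /\
    exists l, hconverges H (fun n => u (phi n)) l.
Proof.
  intros REF. pose (St := ({A : nat -> Prop | infinite_set A} * nat)%type).
  destruct (choice (fun (ks : nat * St) (s' : St) =>
    (forall n, proj1_sig (fst s') n -> proj1_sig (fst (snd ks)) n) /\
    (forall a b, proj1_sig (fst s') a -> proj1_sig (fst s') b ->
       nsq (hsub H (u a) (u b)) <= / INR (S (fst ks))) /\
    proj1_sig (fst s') (snd s') /\ (snd (snd ks) < snd s')%nat)) as [next Hnext].
  { intros [k [[A IA] n]].
    destruct (REF A (/ INR (S k)) IA (inv_INR_S_pos k)) as [B [IB [SB HB]]].
    destruct (IB (S n)) as [m [Hm Bm]]. exists (exist _ B IB, m). simpl. auto. }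
  assert (infinite_set (fun _ => True)) as I0 by (intro N; exists N; split; auto).
  pose (st := fun n => nat_rect (fun _ => St) (exist _ _ I0, O) (fun k s => next (k, s)) n).
  pose (A := fun n => proj1_sig (fst (st n))).
  assert (forall m n, (m <= n)%nat -> forall a, A n a -> A m a) as DEC.
  { intros m n Hmn. induction Hmn; auto. intros a Ha. apply IHHmn.
    apply (Hnext (m0, st m0)). exact Ha. }
  (* The index stored in [st 0] is a dummy, and the first diameter bound holds in [st 1]. *)
  exists (fun n => snd (st (S n))). split.
  - intro n. apply (Hnext (S n, st (S n))).
  - apply cauchy_converges. intros eps He.
    destruct (inv_INR_S_small eps He) as [N HN]. exists N. intros m n Hm Hn.
    apply Rle_lt_trans with (/ INR (S N)); [| apply HN; auto].
    apply (Hnext (N, st N)).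
    + apply (DEC (S N) (S m)); [lia |]. apply (Hnext (m, st m)).
    + apply (DEC (S N) (S n)); [lia |]. apply (Hnext (n, st n)).
Qed.

(** The lower frame inequality with a finite list in place of the whole series. *)
Definition lower_estimate {H : Hilb} {J : Type} (f : J -> H) (c : R) : Prop :=
  forall x, exists G, NoDup G /\ c * nsq x <= lsum G (fun k => csq (hip x (f k))).

(** By self-adjointness c |T x|^2 is bounded by finite sums of |<x, T f_k>|^2. Outside a finite [K0]
    these are small by Cauchy-Schwarz and the tail of the |T f_k|^2; on [K0] finitely many bounded
    scalar sequences are made nearly constant by refinement. *)
Lemma hilbert_schmidt_compact {H : Hilb} {J : Type} (T : H -> H) (f : J -> H) c B :
  bounded_op H T -> self_adjoint H T -> 0 < c -> lower_estimate f c ->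
  (forall F, NoDup F -> lsum F (fun k => nsq (T (f k))) <= B) -> compact_op H T.
Proof.
  intros BO SA Pc LE HB. pose proof BO as [L _]. split; [exact BO |].
  intros u [M0 HM0].
  pose (M := M0 ^ 2 + 1).
  assert (forall n, nsq (u n) <= M) as HM.
  { intro n. rewrite <- hnorm_sqr. specialize (HM0 n). pose proof (hnorm_ge0 (u n)).
    unfold M. nra. }
  assert (0 < M) as PM by (unfold M; nra).
  apply (cauchy_subsequence (fun n => T (u n))). intros A eps IA He.
  pose (a := fun k => nsq (T (f k))).
  assert (forall k, 0 <= a k) as Pa by (intro; apply nsq_ge0).
  (* Differences x of two terms satisfy |x|^2 <= 4 M, so the tail contributes at most half of c
     eps. *)
  destruct (small_tail a B (c * eps / (8 * M)) Pa HB) as [K0 [ND0 T0]].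
  { apply Rdiv_lt_0_compat; nra. }
  (* The other half of c eps, shared among the indices in [K0]; the added 1 covers an empty [K0]. *)
  pose (d := c * eps / (2 * (INR (length K0) + 1))).
  assert (0 < INR (length K0) + 1) as PL by (pose proof (pos_INR (length K0)); lra).
  assert (0 < d) as Pd by (apply Rdiv_lt_0_compat; nra).
  destruct (infinite_set_refine_list (fun k n => hip (u n) (T (f k))) (fun k => M * a k)
    d K0 A Pd) as [A' [IA' [SA' HA']]]; [| exact IA |].
  { intros k n. pose proof (cauchy_schwarz (u n) (T (f k))). specialize (HM n).
    specialize (Pa k). unfold a in *. nra. }
  exists A'. split; [exact IA' |]. split; [exact SA' |]. intros m n Hm Hn.
  rewrite <- linear_sub by exact L.
  set (x := hsub H (u m) (u n)).
  assert (nsq x <= 4 * M) as Hx.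
  { pose proof (nsq_sub_le (u m) (u n)). pose proof (HM m). pose proof (HM n).
    unfold x. lra. }
  pose (h := fun k => csq (hip x (T (f k)))).
  assert (forall k, 0 <= h k) as Ph by (intro; apply csq_ge0).
  destruct (LE (T x)) as [G [NDG HG]].
  rewrite (lsum_ext G _ h) in HG by (intros; rewrite SA; reflexivity).
  rewrite (lsum_split_pred (fun k => In k K0)) in HG.
  set (b := fun k => if excluded_middle_informative (In k K0) then true else false) in HG.
  change (c * nsq (T x) <=
    lsum (filter b G) h + lsum (filter (fun k => negb (b k)) G) h) in HG.
  assert (lsum (filter b G) h <= c * eps / 2) as S1.
  { apply Rle_trans with (lsum K0 h).
    - apply lsum_incl; auto; [apply NoDup_filter, NDG |].
      intros k Hk. apply filter_In in Hk. destruct Hk as [_ Hk]. unfold b in Hk.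
      destruct (excluded_middle_informative (In k K0)); [assumption | discriminate].
    - apply Rle_trans with (lsum K0 (fun _ => d)).
      + apply lsum_le. intros k Hk. pose proof (HA' k m n Hk Hm Hn) as Q.
        unfold h, x, hsub. autorewrite with hip. exact Q.
      + rewrite lsum_const.
        apply Rle_trans with ((INR (length K0) + 1) * d); [nra |].
        apply Req_le. unfold d. field. lra. }
  assert (lsum (filter (fun k => negb (b k)) G) h <= c * eps / 2) as S2.
  { set (Q := filter (fun k => negb (b k)) G).
    assert (lsum Q a <= c * eps / (8 * M)) as SQ.
    { assert (NoDup (K0 ++ Q)) as NDQ.
      { apply NoDup_app; auto; [apply NoDup_filter, NDG |].
        intros k Hk Hk2. apply filter_In in Hk2. destruct Hk2 as [_ Hk2]. unfold b in Hk2.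
        destruct (excluded_middle_informative (In k K0)); [discriminate | contradiction]. }
      specialize (T0 _ NDQ). rewrite lsum_app in T0. lra. }
    apply Rle_trans with (4 * M * lsum Q a).
    - rewrite <- lsum_scal. apply lsum_le. intros k _.
      pose proof (cauchy_schwarz x (T (f k))). specialize (Pa k). unfold h, a in *. nra.
    - apply Rle_trans with (4 * M * (c * eps / (8 * M))).
      + apply Rmult_le_compat_l; [lra | exact SQ].
      + apply Req_le. field. lra. }
  apply Rmult_le_reg_l with c; [exact Pc | lra].
Qed.

(** * Frames *)

Lemma frame_sum_csq {H : Hilb} {J : Type} (f : J -> H) x s :
  frame_sum H f x s <-> usum (fun k => csq (hip x (f k))) s.
Proof.
  unfold frame_sum.
  replace (fun n => Cabs (hip x (f n)) ^ 2) with (fun k => csq (hip x (f k))); [tauto |].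
  apply functional_extensionality. intro k. symmetry. apply Cabs_sqr.
Qed.

(** For x nonzero, c' |x|^2 lies strictly below the supremum of the finite sums, so one of them
    exceeds it. *)
Lemma lower_estimate_of_frame {H : Hilb} {J : Type} (f : J -> H) c c' :
  (forall x, exists s, frame_sum H f x s /\ c * nsq x <= s) -> c' < c -> lower_estimate f c'.
Proof.
  intros HF Hc x. destruct (classic (x = hzero)) as [-> | N].
  - exists nil. split; [constructor |]. simpl. rewrite nsq_zero. lra.
  - assert (0 < nsq x) as P by (apply Rnot_le_lt; intro; apply N, nsq_eq0; assumption).
    destruct (HF x) as [s [HS LB]]. apply frame_sum_csq in HS. destruct HS as [_ HS].
    apply NNPP. intro Q. assert (s <= c' * nsq x); [| nra].
    apply HS. intros r [l [ND ->]]. apply Rnot_lt_le. intro. apply Q. exists l.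
    split; [assumption | lra].
Qed.

(** A common list for finitely many vectors keeps all later double sums finite, so they can be
    interchanged freely. *)
Lemma lower_estimate_list {H : Hilb} {J : Type} (f : J -> H) c (xs : list H) :
  lower_estimate f c -> exists G, NoDup G /\
    forall x, In x xs -> c * nsq x <= lsum G (fun k => csq (hip x (f k))).
Proof.
  intros LE. induction xs as [| y xs [G [ND HG]]].
  - exists nil. split; [constructor | simpl; tauto].
  - destruct (LE y) as [G' [ND' HG']].
    destruct (NoDup_union G G') as [U [NDU [I1 I2]]]. exists U. split; [exact NDU |].
    intros x [<- | Hx].
    + apply Rle_trans with (1 := HG'). apply lsum_incl; auto. intro. apply csq_ge0.
    + apply Rle_trans with (1 := HG x Hx). apply lsum_incl; auto. intro. apply csq_ge0.
Qed.

(** [dsum] ranges over squares l x l, whereas the estimates choose the lists for the two indices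
    separately. With nonnegative entries a rectangle fits into the square over the union. *)
Definition dbounded {J : Type} (a : J -> J -> R) (W : R) : Prop :=
  forall F G, NoDup F -> NoDup G -> lsum F (fun n => lsum G (fun k => a n k)) <= W.

Lemma dsum_dbounded {J : Type} (a : J -> J -> R) W :
  (forall n k, 0 <= a n k) -> dsum a W -> dbounded a W.
Proof.
  intros P [UB _] F G NF NG. destruct (NoDup_union F G) as [U [NDU [I1 I2]]].
  apply Rle_trans with (lsum U (fun n => lsum U (fun k => a n k))); [| apply UB; eauto].
  apply Rle_trans with (lsum F (fun n => lsum U (fun k => a n k))).
  - apply lsum_le. intros. apply lsum_incl; auto.
  - apply lsum_incl; auto. intro. apply lsum_ge0. auto.
Qed.

Lemma dbounded_scal_le {J : Type} (a b : J -> J -> R) K W : 0 <= K ->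
  (forall n k, a n k <= K * b n k) -> dbounded b W -> dbounded a (K * W).
Proof.
  intros PK L HB F G NF NG.
  apply Rle_trans with (K * lsum F (fun n => lsum G (fun k => b n k))).
  - rewrite <- lsum_scal. apply lsum_le. intros. rewrite <- lsum_scal. apply lsum_le. auto.
  - apply Rmult_le_compat_l; auto.
Qed.

Lemma dbounded_ge0 {J : Type} (a : J -> J -> R) W : dbounded a W -> 0 <= W.
Proof. intros HB. apply (HB nil nil); constructor. Qed.

Lemma rpow_Cabs z p : rpow (Cabs z) p = rpow (csq z) (p / 2).
Proof.
  rewrite <- Cabs_sqr, rpow_sqr by apply Cabs_ge0. f_equal. field.
Qed.

Lemma rpow_hnorm {H : Hilb} (x : H) p : rpow (hnorm H x) (2 - p) = rpow (nsq x) (1 - p / 2).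
Proof.
  rewrite <- hnorm_sqr, rpow_sqr by apply hnorm_ge0. f_equal. field.
Qed.

Lemma rpow_Rabs t p : rpow (Rabs t) p = rpow (t ^ 2) (p / 2).
Proof. rewrite <- pow2_abs, rpow_sqr by apply Rabs_pos. f_equal. field. Qed.

(* With weights [w_i = |<f_n, E_i>|^2], Hoelder's inequality reads
   [sum_i |tau_i|^p w_i <= |T f_n|^p |f_n|^(2-p)]; the lower frame estimate is used
   once at the [E_i] and once at the [T f_n]. *)
Lemma eigenvalue_sum_le {H : Hilb} {I J : Type} (T : H -> H) (E : I -> H) tau (f : J -> H) c p W :
  0 < p <= 2 -> self_adjoint H T -> ONB H E ->
  (forall i, T (E i) = hscal (RtoC (tau i)) (E i)) -> 0 < c -> lower_estimate f c ->
  dbounded (fun n k => rpow (hnorm H (f n)) (2 - p) * rpow (Cabs (hip (T (f n)) (f k))) p) W ->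
  forall l, NoDup l -> c * rpow c (p / 2) * lsum l (fun i => rpow (Rabs (tau i)) p) <= W.
Proof.
  intros Hp SA O ET Pc LE HW l ND. set (q := p / 2).
  assert (0 < q <= 1) as Pq by (unfold q; lra).
  destruct (lower_estimate_list f c (map E l) LE) as [F [NF HF]].
  destruct (lower_estimate_list f c (map (fun n => T (f n)) F) LE) as [G [NG HG]].
  assert (c * lsum l (fun i => rpow (Rabs (tau i)) p) <=
    lsum F (fun n => rpow (nsq (T (f n))) q * rpow (nsq (f n)) (1 - q))) as S1.
  { apply Rle_trans with (lsum l (fun i => lsum F (fun n =>
      csq (hip (f n) (E i)) * rpow (tau i ^ 2) q))).
    - rewrite <- lsum_scal. apply lsum_le. intros i Hi. rewrite rpow_Rabs. fold q.
      rewrite (lsum_ext F _ (fun n => rpow (tau i ^ 2) q * csq (hip (E i) (f n)))).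
      + rewrite lsum_scal, Rmult_comm. apply Rmult_le_compat_l; [apply rpow_ge0 |].
        specialize (HF (E i) (in_map E l i Hi)). unfold nsq in HF.
        rewrite (proj1 O) in HF. simpl fst in HF. lra.
      + intros n _. rewrite (hip_conj _ (E i) (f n)), csq_conj. ring.
    - rewrite lsum_swap. apply lsum_le. intros n _.
      pose proof (ONB_orthofam E O) as OF.
      apply (rpow_holder l (fun i => csq (hip (f n) (E i))) (fun i => tau i ^ 2)); auto.
      + intro. apply csq_ge0.
      + intro. apply pow2_ge_0.
      + apply Rle_trans with (2 := bessel E l (T (f n)) OF ND). apply Req_le.
        apply lsum_ext. intros i _. rewrite (hip_eigenvector T _ (E i) (tau i)) by auto.
        rewrite csq_mul, csq_RtoC. ring.
      + apply bessel; auto. }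
  assert (rpow c q * lsum F (fun n => rpow (nsq (T (f n))) q * rpow (nsq (f n)) (1 - q)) <= W)
    as S2.
  { apply Rle_trans with (2 := HW F G NF NG). rewrite <- lsum_scal. apply lsum_le.
    intros n Hn. rewrite rpow_hnorm. fold q. rewrite lsum_scal.
    replace (rpow c q * (rpow (nsq (T (f n))) q * rpow (nsq (f n)) (1 - q)))
      with (rpow (nsq (f n)) (1 - q) * rpow (c * nsq (T (f n))) q)
      by (rewrite rpow_mult by (lra || apply nsq_ge0); ring).
    apply Rmult_le_compat_l; [apply rpow_ge0 |].
    apply Rle_trans with (rpow (lsum G (fun k => csq (hip (T (f n)) (f k)))) q).
    - apply rpow_le; [lra |]. split; [apply Rmult_le_pos; [lra | apply nsq_ge0] |].
      apply HG, (in_map (fun n => T (f n)) F n Hn).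
    - apply Rle_trans with (1 := rpow_lsum_le G (fun k => csq (hip (T (f n)) (f k))) q Pq
        (fun k => csq_ge0 _)).
      apply Req_le, lsum_ext. intros k _. symmetry. apply rpow_Cabs. }
  pose proof (rpow_ge0 c q). nra.
Qed.

(** With q = p/2, subadditivity of t^q over n and then over k bounds the q-th power of the double
    square sum by [W]; the exponent 1/q undoes the power, and dividing by [c] removes the sum over
    k. *)
Lemma hilbert_schmidt_bound {H : Hilb} {J : Type} (T : H -> H) (f : J -> H) c p W :
  0 < p <= 2 -> 0 < c -> lower_estimate f c ->
  dbounded (fun n k => rpow (Cabs (hip (T (f n)) (f k))) p) W ->
  forall F, NoDup F -> lsum F (fun n => nsq (T (f n))) <= rpow W (/ (p / 2)) / c.
Proof.
  intros Hp Pc LE HW F NF. set (q := p / 2).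
  assert (0 < q <= 1) as Pq by (unfold q; lra).
  destruct (lower_estimate_list f c (map (fun n => T (f n)) F) LE) as [G [NG HG]].
  set (S := lsum F (fun n => lsum G (fun k => csq (hip (T (f n)) (f k))))).
  assert (forall n, 0 <= lsum G (fun k => csq (hip (T (f n)) (f k)))) as PG
    by (intro; apply lsum_ge0; intro; apply csq_ge0).
  assert (0 <= S) as PS by (apply lsum_ge0, PG).
  assert (c * lsum F (fun n => nsq (T (f n))) <= S) as S1.
  { rewrite <- lsum_scal. apply lsum_le. intros n Hn.
    apply HG, (in_map (fun n => T (f n)) F n Hn). }
  assert (rpow S q <= W) as S2.
  { apply Rle_trans with (2 := HW F G NF NG).
    apply Rle_trans with (1 := rpow_lsum_le F _ q Pq PG). apply lsum_le. intros n _.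
    apply Rle_trans with (1 := rpow_lsum_le G (fun k => csq (hip (T (f n)) (f k))) q Pq
      (fun k => csq_ge0 _)).
    apply Req_le, lsum_ext. intros k _. symmetry. apply rpow_Cabs. }
  assert (S <= rpow W (/ q)) as S3.
  { rewrite <- (rpow_exp1 S PS). rewrite <- (Rinv_r q) by lra. rewrite <- rpow_rpow by auto.
    apply rpow_le; [apply Rlt_le, Rinv_0_lt_compat; lra |]. split; [apply rpow_ge0 | auto]. }
  apply Rmult_le_reg_l with c; [exact Pc |].
  replace (c * (rpow W (/ q) / c)) with (rpow W (/ q)) by (field; lra). lra.
Qed.

(** * Frame bounds, and orthonormal bases as Parseval frames *)

Lemma frame_vector_le {H : Hilb} {J : Type} (f : J -> H) K n : 0 <= K ->
  (forall x, exists s, frame_sum H f x s /\ s <= K * nsq x) -> nsq (f n) <= K.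
Proof.
  intros PK HF. destruct (HF (f n)) as [s [HS UB]]. apply frame_sum_csq in HS.
  (* Keeping only the n-th term of the frame sum of [f n] gives |f_n|^4 <= K |f_n|^2. *)
  assert (csq (hip (f n) (f n)) <= s) as Q.
  { apply HS. exists (n :: nil). split; [repeat constructor; simpl; tauto | simpl; ring]. }
  rewrite hip_self, csq_RtoC in Q. pose proof (nsq_ge0 (f n)).
  destruct (Rle_lt_dec (nsq (f n)) 0); [lra |].
  apply Rmult_le_reg_r with (nsq (f n)); [assumption | nra].
Qed.

(** For x nonzero every admissible constant is at most s/|x|^2, hence so is their supremum: the
    optimal bound is itself valid. *)
Lemma lower_frame_bound_le {H : Hilb} {J : Type} (f : J -> H) A x s :
  frame H f -> lower_frame_bound H f A -> frame_sum H f x s -> A * nsq x <= s.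
Proof.
  intros [c1 [c2 [Hc HF]]] [_ LA] HS.
  destruct (HF x) as [s' [HS' [LB _]]].
  assert (s' = s) as -> by (apply (is_lub_u _ _ _ HS' HS)). rewrite hnorm_sqr in LB.
  destruct (Rle_lt_dec (nsq x) 0) as [Z | P].
  - pose proof (nsq_ge0 x). replace (nsq x) with 0 in * by lra. lra.
  - apply Rmult_le_reg_r with (/ nsq x); [apply Rinv_0_lt_compat, P |].
    rewrite Rmult_assoc, Rinv_r, Rmult_1_r by lra.
    apply LA. intros c [Pc Q]. specialize (Q x s HS). rewrite hnorm_sqr in Q.
    apply Rmult_le_reg_r with (nsq x); [exact P |].
    rewrite Rmult_assoc, Rinv_l by lra. lra.
Qed.

Lemma upper_frame_bound_ge {H : Hilb} {J : Type} (f : J -> H) B x s :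
  frame H f -> upper_frame_bound H f B -> frame_sum H f x s -> s <= B * nsq x.
Proof.
  intros [c1 [c2 [Hc HF]]] [_ GB] HS.
  destruct (HF x) as [s' [HS' [_ UB]]].
  assert (s' = s) as -> by (apply (is_lub_u _ _ _ HS' HS)). rewrite hnorm_sqr in UB.
  destruct (Rle_lt_dec (nsq x) 0) as [Z | P].
  - pose proof (nsq_ge0 x). replace (nsq x) with 0 in * by lra. lra.
  - apply Rmult_le_reg_r with (/ nsq x); [apply Rinv_0_lt_compat, P |].
    rewrite (Rmult_assoc B), Rinv_r, Rmult_1_r by lra.
    apply GB. intros c [Pc Q]. specialize (Q x s HS). rewrite hnorm_sqr in Q.
    apply Rmult_le_reg_r with (nsq x); [exact P |].
    rewrite Rmult_assoc, Rinv_l by lra. lra.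
Qed.

Lemma ONB_frame_sum {H : Hilb} {I : Type} (E : I -> H) x s :
  ONB H E -> (frame_sum H E x s <-> s = nsq x).
Proof.
  intros O. rewrite frame_sum_csq. pose proof (parseval_identity E x O) as P. split.
  - intro Q. apply (is_lub_u _ _ _ Q P).
  - intros ->. exact P.
Qed.

Lemma ONB_frame {H : Hilb} {I : Type} (E : I -> H) : ONB H E -> frame H E.
Proof.
  intros O. exists 1, 1. split; [lra |]. intro x. exists (nsq x).
  rewrite ONB_frame_sum, hnorm_sqr by auto. repeat split; lra.
Qed.

(** A nonzero vector pins both bounds to 1. In the zero space every positive constant is admissible
    and the lower frame bound does not exist. *)
Lemma ONB_parseval {H : Hilb} {I : Type} (E : I -> H) (x : H) :
  x <> hzero -> ONB H E -> parseval H E.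
Proof.
  intros N O. assert (0 < nsq x) as P by (apply Rnot_le_lt; intro; apply N, nsq_eq0; assumption).
  split; [apply ONB_frame, O |]. split; split.
  - intros c [_ Hc]. specialize (Hc x (nsq x)).
    rewrite ONB_frame_sum, hnorm_sqr in Hc by auto. specialize (Hc eq_refl). nra.
  - intros b Hb. apply Hb. split; [lra |]. intros y s Hs. apply ONB_frame_sum in Hs; [| auto].
    rewrite hnorm_sqr. lra.
  - intros c [_ Hc]. specialize (Hc x (nsq x)).
    rewrite ONB_frame_sum, hnorm_sqr in Hc by auto. specialize (Hc eq_refl). nra.
  - intros b Hb. apply Hb. split; [lra |]. intros y s Hs. apply ONB_frame_sum in Hs; [| auto].
    rewrite hnorm_sqr. lra.
Qed.

Lemma lsum_single {I : Type} (l : list I) a n : NoDup l -> In n l ->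
  (forall k, k <> n -> a k = 0) -> lsum l a = a n.
Proof.
  intros ND Hn HZ. induction l as [| i l IH]; simpl in *; [tauto |].
  inversion ND; subst. destruct Hn as [<- | Hn].
  - rewrite lsum_eq0; [ring |]. intros k Hk. apply HZ. intros ->. contradiction.
  - rewrite IH by auto. rewrite HZ; [ring |]. intros ->. contradiction.
Qed.

Lemma eigenbasis_mat_sum {H : Hilb} {I : Type} (T : H -> H) (E : I -> H) tau p v :
  ONB H E -> (forall i, T (E i) = hscal (RtoC (tau i)) (E i)) ->
  usum (fun i => rpow (Rabs (tau i)) p) v -> mat_sum H p T E v.
Proof.
  intros [U [O _]] ET [UB LB].
  assert (forall l, NoDup l ->
    lsum l (fun n => lsum l (fun k => rpow (Cabs (hip (T (E n)) (E k))) p)) =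
    lsum l (fun i => rpow (Rabs (tau i)) p)) as K.
  { intros l ND. apply lsum_ext. intros n Hn. rewrite (lsum_single l _ n); auto.
    - rewrite rpow_Cabs, rpow_Rabs, ET, hip_scal, U, csq_mul, csq_RtoC.
      f_equal. unfold csq, C1. simpl. ring.
    - intros k Hk. rewrite rpow_Cabs, ET, hip_scal, O, csq_mul, csq_C0, Rmult_0_r by auto.
      apply rpow_0. }
  split.
  - intros r [l [ND ->]]. rewrite K by auto. apply UB. eauto.
  - intros b Hb. apply LB. intros r [l [ND ->]]. rewrite <- K by auto. apply Hb. eauto.
Qed.

Lemma ONB_wmat_sum {H : Hilb} {I : Type} (T : H -> H) (E : I -> H) p v :
  ONB H E -> mat_sum H p T E v -> wmat_sum H p T E v.
Proof.
  intros [U _]. unfold mat_sum, wmat_sum.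
  replace (fun n k => rpow (hnorm H (E n)) (2 - p) * rpow (Cabs (hip (T (E n)) (E k))) p)
    with (fun n k => rpow (Cabs (hip (T (E n)) (E k))) p); [tauto |].
  apply functional_extensionality. intro n. apply functional_extensionality. intro k.
  unfold hnorm. rewrite U. simpl fst. rewrite sqrt_1, rpow_1. ring.
Qed.

(** Passes from plain to weighted sums at the cost of a power of [K]: the upper constant for a
    general frame, and 1 for a Parseval frame. *)
Lemma wmat_dbounded {H : Hilb} {J : Type} (T : H -> H) (f : J -> H) p K s :
  p <= 2 -> (forall n, nsq (f n) <= K) -> mat_sum H p T f s ->
  dbounded (fun n k => rpow (hnorm H (f n)) (2 - p) * rpow (Cabs (hip (T (f n)) (f k))) p)
    (rpow K (1 - p / 2) * s).
Proof.
  intros Hp HK MS.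
  apply (dbounded_scal_le _ (fun n k => rpow (Cabs (hip (T (f n)) (f k))) p)).
  - apply rpow_ge0.
  - intros n k. apply Rmult_le_compat_r; [apply rpow_ge0 |]. rewrite rpow_hnorm.
    apply rpow_le; [lra |]. split; [apply nsq_ge0 | apply HK].
  - apply dsum_dbounded; [intros; apply rpow_ge0 | exact MS].
Qed.

(** * Membership in the Schatten class and the three infima *)

Lemma frame_In_Sp {H : Hilb} {J : Type} (T : H -> H) (f : J -> H) p s :
  separable H -> 0 < p <= 2 -> bounded_op H T -> self_adjoint H T ->
  frame H f -> mat_sum H p T f s -> In_Sp H p T.
Proof.
  intros Hsep Hp BO SA [c1 [c2 [Hc HF]]] MS.
  (* Any constant below [c1] would do, since only finiteness of the sums is at stake here. *)
  assert (lower_estimate f (c1 / 2)) as LE.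
  { apply (lower_estimate_of_frame f c1); [| lra]. intro x.
    destruct (HF x) as [r [Q1 [Q2 _]]]. rewrite hnorm_sqr in Q2. eauto. }
  assert (compact_op H T) as CO.
  { eapply (hilbert_schmidt_compact T f (c1 / 2)); eauto; [lra |].
    apply (hilbert_schmidt_bound T f (c1 / 2) p s); auto; [lra |].
    apply dsum_dbounded; [intros; apply rpow_ge0 | exact MS]. }
  destruct (spectral_theorem T Hsep CO SA) as [I [E [tau [nu [lam [CI ES]]]]]].
  split; [exact CO |]. exists lam.
  split; [apply (eigensystem_sing_vals T E tau nu); auto |].
  pose proof ES as [O [ET _]].
  pose (c := c1 / 2 * rpow (c1 / 2) (p / 2)).
  assert (0 < c) as Pc.
  { apply Rmult_lt_0_compat; [lra |]. rewrite rpow_pos by lra. apply exp_pos. }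
  apply (infinite_sum_of_bounded T E tau nu lam p (rpow c2 (1 - p / 2) * s / c) ES).
  intros l ND. apply Rmult_le_reg_l with c; [exact Pc |].
  replace (c * (rpow c2 (1 - p / 2) * s / c)) with (rpow c2 (1 - p / 2) * s) by (field; lra).
  apply (eigenvalue_sum_le T E tau f); auto; [lra |].
  apply wmat_dbounded; [lra | | exact MS].
  intro n. apply (frame_vector_le f); [lra |]. intro x.
  destruct (HF x) as [r [Q1 [_ Q2]]]. rewrite hnorm_sqr in Q2. eauto.
Qed.

(** Finite lists give only constants c < 1. For these c^2 <= c c^(p/2), a bound free of p that tends
    to 1. *)
Lemma eigenvalue_sum_le_lower_bound_1 {H : Hilb} {I J : Type} (T : H -> H) (E : I -> H) tau
    (f : J -> H) p W A :
  0 < p <= 2 -> self_adjoint H T -> ONB H E ->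
  (forall i, T (E i) = hscal (RtoC (tau i)) (E i)) ->
  frame H f -> lower_frame_bound H f A -> 1 <= A ->
  dbounded (fun n k => rpow (hnorm H (f n)) (2 - p) * rpow (Cabs (hip (T (f n)) (f k))) p) W ->
  forall l, NoDup l -> lsum l (fun i => rpow (Rabs (tau i)) p) <= W.
Proof.
  intros Hp SA O ET FR LFB HA HW l ND.
  set (S := lsum l (fun i => rpow (Rabs (tau i)) p)).
  assert (0 <= S) as PS by (apply lsum_ge0; intro; apply rpow_ge0).
  pose proof (dbounded_ge0 _ W HW) as PW.
  assert (forall c, 0 < c < 1 -> c ^ 2 * S <= W) as K.
  { intros c Hc.
    assert (lower_estimate f c) as LE.
    { apply (lower_estimate_of_frame f A); [| lra]. intro x.
      pose proof FR as [c1 [c2 [_ HF]]]. destruct (HF x) as [s [HS _]]. exists s.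
      split; [exact HS |]. apply (lower_frame_bound_le f); auto. }
    pose proof (eigenvalue_sum_le T E tau f c p W Hp SA O ET (proj1 Hc) LE HW l ND) as Q.
    fold S in Q. assert (c <= rpow c (p / 2)) by (apply rpow_ge_self; lra).
    apply Rle_trans with (2 := Q). apply Rmult_le_compat_r; [exact PS |].
    simpl. rewrite Rmult_1_r. apply Rmult_le_compat_l; lra. }
  (* For c = 1 - eps, (1 - eps)^2 S <= W yields S - W <= 2 S eps; for eps >= 1 this follows from W
     >= 0. *)
  assert (S - W <= 0); [| lra]. apply (arbitrarily_small _ (2 * S)). intros eps He.
  destruct (Rlt_le_dec eps 1) as [L | L]; [| nra].
  specialize (K (1 - eps)). assert (0 < 1 - eps < 1) as Q by lra. specialize (K Q).
  assert (0 <= S * eps ^ 2) by (apply Rmult_le_pos; [exact PS | apply pow2_ge_0]). nra.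
Qed.

Lemma infinite_sum_ext (a b : nat -> R) v :
  (forall n, a n = b n) -> infinite_sum a v -> infinite_sum b v.
Proof.
  intros E. replace b with a; [tauto |]. apply functional_extensionality, E.
Qed.

Lemma Schatten_eigenbasis {H : Hilb} (T : H -> H) p lam' v :
  separable H -> compact_op H T -> self_adjoint H T ->
  sing_vals H T lam' -> infinite_sum (fun n => rpow (lam' n) p) v ->
  exists (I : Type) (E : I -> H) (tau : I -> R), countable I /\ ONB H E /\
    (forall i, T (E i) = hscal (RtoC (tau i)) (E i)) /\
    usum (fun i => rpow (Rabs (tau i)) p) v.
Proof.
  intros Hsep CO SA SV IS.
  destruct (spectral_theorem T Hsep CO SA) as [I [E [tau [nu [lam [CI ES]]]]]].
  exists I, E, tau. pose proof ES as [O [ET _]]. repeat split; auto; try apply O;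
    apply (usum_of_infinite_sum T E tau nu lam p v ES);
    apply (infinite_sum_ext (fun n => rpow (lam' n) p)); auto;
    intro n; f_equal; apply (sing_vals_eigensystem T E tau nu); auto; apply CO.
Qed.

Theorem theorem18 (H : Hilb) (p : R) (T : H -> H)
  (Hsep : separable H) (Hnontriv : exists x : H, x <> hzero)
  (Hp : 0 < p <= 2) (HT : bounded_op H T) (HTsa : self_adjoint H T) :
  (In_Sp H p T <->
     exists (I : Type) (e : I -> H), countable I /\ ONB H e /\ exists s, mat_sum H p T e s) /\
  (In_Sp H p T <->
     exists (I : Type) (f : I -> H), countable I /\ frame H f /\ exists s, mat_sum H p T f s) /\
  (forall v, Sp_normp H p T v ->
     is_glb (ONB_vals H p T) v /\
     is_glb (frame1_wvals H p T) v /\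
     is_glb (parseval_vals H p T) v).
Proof.
  assert (In_Sp H p T -> exists (I : Type) (e : I -> H),
    countable I /\ ONB H e /\ exists s, mat_sum H p T e s) as AB.
  { intros [CO [lam' [SV [s IS]]]].
    destruct (Schatten_eigenbasis T p lam' s Hsep CO HTsa SV IS)
      as [I [E [tau [CI [O [ET US]]]]]].
    exists I, E. repeat split; auto; try apply O. exists s.
    apply (eigenbasis_mat_sum T E tau); auto. }
  split; [| split].
  - split; [exact AB |]. intros [I [e [_ [O [s MS]]]]].
    apply (frame_In_Sp T e p s); auto. apply ONB_frame, O.
  - split.
    + intro Q. destruct (AB Q) as [I [e [CI [O MS]]]]. exists I, e.
      repeat split; auto. apply ONB_frame, O.
    + intros [I [f [_ [FR [s MS]]]]]. apply (frame_In_Sp T f p s); auto.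
  - intros v [[CO _] [lam' [SV IS]]]. destruct Hnontriv as [x0 Nx0].
    destruct (Schatten_eigenbasis T p lam' v Hsep CO HTsa SV IS)
      as [I [E [tau [CI [O [ET US]]]]]].
    pose proof (eigenbasis_mat_sum T E tau p v O ET US) as ME.
    pose proof (ONB_parseval E x0 Nx0 O) as PE.
    assert (forall r, frame1_wvals H p T r -> v <= r) as LW.
    { intros r [J [f [_ [FR [[A [LFB HA]] WS]]]]]. apply US. intros w [l [ND ->]].
      apply (eigenvalue_sum_le_lower_bound_1 T E tau f p r A); auto.
      apply dsum_dbounded; [| exact WS]. intros. apply Rmult_le_pos; apply rpow_ge0. }
    assert (forall r, parseval_vals H p T r -> v <= r) as LP.
    { intros r [J [f [_ [[FR [LFB UFB]] MS]]]]. apply US. intros w [l [ND ->]].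
      apply (eigenvalue_sum_le_lower_bound_1 T E tau f p r 1); auto; [lra |].
      (* Vectors of a Parseval frame have norm at most 1, so the weights cost a factor 1. *)
      replace r with (rpow 1 (1 - p / 2) * r) by (rewrite rpow_1; ring).
      apply wmat_dbounded; [lra | | exact MS].
      intro n. apply (frame_vector_le f); [lra |]. intro x.
      pose proof FR as [c1 [c2 [_ HF]]]. destruct (HF x) as [s [HS _]]. exists s.
      split; [exact HS |]. apply (upper_frame_bound_ge f); auto. }
    split; [| split]; split; auto.
    (* Every orthonormal basis is a Parseval frame with the same sum, so its lower bound is
       inherited. *)
    + intros r [J [e [CJ [O' MS]]]]. apply LP. exists J, e. split; [exact CJ |].
      split; [apply (ONB_parseval e x0 Nx0 O') | exact MS].
    + intros b Hb. apply Hb. exists I, E. auto.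
    + intros b Hb. apply Hb. exists I, E. split; [exact CI |]. split; [apply PE |].
      split; [| apply ONB_wmat_sum; auto].
      exists 1. split; [apply PE | lra].
    + intros b Hb. apply Hb. exists I, E. auto.
Qed.
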